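(* Let $d\ge 1$ and $r\ge 0$ be integers, let $k\ge 2^d r+1$ be an integer, let $\mathcal T$ be a conforming simplicial triangulation of a domain $\Omega\subset\mathbb R^d$, and let $\mathcal P_k(K)$ be the space of polynomials of degree not greater than $k$ on a $d$-dimensional simplex $K\in\mathcal T$. For each $(d-s)$-dimensional subsimplex $F$ of $\mathcal T$ ($0\le s\le d$) and each integer $n$ with $0\le n\le 2^{s-1}r$ (and $n=0$ when $s=0$), let $$\mathcal B_{F,n,k}:=\operatorname{span}\{\lambda_{F,s}^{\sigma_s}\cdots\lambda_{F,d}^{\sigma_d}\},$$ where $\lambda_{F,s},\dots,\lambda_{F,d}$ are the barycentric coordinates of $F$ and $(\sigma_s,\dots,\sigma_d)$ ranges over all tuples of nonnegative integers such that $$\sum_{i=s}^d\sigma_i=k-n$$ and $$\sigma_{i_1}+\cdots+\sigma_{i_l}>2^{l+s-1}r-n\quad\text{for all } \{i_1,\dots,i_l\}\subsetneq\{s,\dots,d\},\ l=1,\dots,d-s.$$ For $u\in\mathcal P_k(K)$, consider as degrees of freedom, for every subsimplex $F$ of $K$ of codimension $s$ ($0\le s\le d$), every integer $n$ with $0\le n\le 2^{s-1}r$ (and $n=0$ when $s=0$), and every $\theta=(\theta_1,\dots,\theta_s)\in\mathbb N_0^s$ with $\sum_{i=1}^s\theta_i=n$, the quantities $$\frac1{|F|}\int_F (D^\theta u)\cdot v\quad\text{for all } v\in\mathcal B_{F,n,k},\ \text{if } F \text{ is not a vertex},$$ $$D^\theta u(F)\cdot v(F)\quad\text{for all } v\in\mathcal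 B_{F,n,k},\ \text{if } F\text{ is a vertex}.$$ Then this set of degrees of freedom is unisolvent for the shape function space $\mathcal P_k(K)$, and the resulting finite element space is of $C^r$ continuity (i.e. contained in $C^r(\Omega)$).
   Context: A subsimplex of $K$ is the convex hull of a nonempty subset of the vertices of $K$ (so $K$ itself is the subsimplex with $s=0$, and vertices are those with $s=d$). For each subsimplex $F$ of $\mathcal T$ of codimension $s$, orthonormal unit normal vectors $\mathbf n_1,\dots,\mathbf n_s$ of $F$ (an orthonormal basis of the orthogonal complement of the directions tangent to $F$) are fixed, the same for all elements containing $F$, and $$D^\theta:=\frac{\partial^n}{\partial\mathbf n_1^{\theta_1}\cdots\partial\mathbf n_s^{\theta_s}},\qquad n=\sum_{i=1}^s\theta_i,$$ with $D^\theta u=u$ when $n=0$. On a vertex $F=\mathbf x$ the single barycentric coordinate is $\lambda_{\mathbf x}=1$. The barycentric coordinates of $F$ are the restrictions to $F$ of the barycentric coordinates of $K$ attached to the vertices of $F$. The precise number of degrees of freedom attached to a pair $(F,\theta)$ is $\dim\mathcal B_{F,n,k}$: $v$ runs over a basis of $\mathcal B_{F,n,k}$. Unisolvent for $\mathcal P_k(K)$ means that the total number of degrees of freedom equals $\dim\mathcal P_k(K)$ and the only $u\in\mathcal P_k(K)$ on which all degrees of freedom vanish is $u=0$. The resulting finite element space is the set of $u\in L^2(\Omega)$ with $u|_K\in\mathcal P_k(K)$ for every $d$-simplex $K\in\mathcal T$ such that, for each subsimplex $F$ of dimension $\le d-1$ and any two $d$-simplices $K^+,K^-\in\mathcal T$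 sharing $F$, every degree of freedom attached to $F$ takes the same value on $u|_{K^+}$ and $u|_{K^-}$. Membership in $C^r(\Omega)$ is understood up to modification on a set of measure zero. *)

(* Defs.v *)
From HB Require Import structures.
From mathcomp Require Import all_boot all_order all_algebra finmap.
From mathcomp Require Import all_classical all_reals all_analysis.
Set Implicit Arguments.
Unset Strict Implicit.
Unset Printing Implicit Defensive.
Import Order.TTheory GRing.Theory Num.Theory.
Import numFieldNormedType.Exports.
Local Open Scope classical_set_scope.
Local Open Scope ring_scope.

(* The product sigma-algebra on R^n (which is its Borel sigma-algebra). *)
Section measurable_rV.
Context {R : realType}.
Variable n : nat.

Let coors : 'I_n -> 'rV[R]_n -> measurableTypeR R := fun i x => x 0 i.

Let rV_set0 : g_sigma_preimage coors set0.
Proof. exact: sigma_algebra0. Qed.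

Let rV_setC A : g_sigma_preimage coors A -> g_sigma_preimage coors (~` A).
Proof. exact: sigma_algebraC. Qed.

Let rV_bigcup (F : _^nat) : (forall i, g_sigma_preimage coors (F i)) ->
  g_sigma_preimage coors (\bigcup_i (F i)).
Proof. exact: sigma_algebra_bigcup. Qed.

HB.instance Definition _ := @isMeasurable.Build default_measure_display
  'rV[R]_n (g_sigma_preimage coors) rV_set0 rV_setC rV_bigcup.

Lemma measurable_coord (i : 'I_n) : measurable_fun setT (coors i).
Proof.
move=> _ Y mY; rewrite setTI; apply: sub_sigma_algebra => /=.
rewrite -bigcup_seq/=; exists i => /=; first by rewrite mem_index_enum.
by exists Y => //; rewrite setTI.
Qed.

Lemma measurable_fun_rV d (T : measurableType d) (f : T -> 'rV[R]_n) :
  (forall i, measurable_fun setT (coors i \o f)) -> measurable_fun setT f.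
Proof.
move=> mf; have H : g_sigma_preimage (fun i => coors i \o f) `<=` measurable.
  apply: smallest_sub; first exact: sigma_algebra_measurable.
  rewrite -bigcup_seq/=; apply: bigcup_sub => i _.
  by move=> A [B mB <-]; exact: mf.
by move=> _ A mA; apply: H; rewrite g_sigma_preimage_comp; exists A.
Qed.

End measurable_rV.

Section lebesgue_rV.
Context {R : realType}.

Definition cons_rV n (p : measurableTypeR R * 'rV[R]_n) : 'rV[R]_n.+1 :=
  \row_i (if unlift ord0 i is Some j then p.2 0 j else p.1).

Definition uncons_rV n (x : 'rV[R]_n.+1) : measurableTypeR R * 'rV[R]_n :=
  (x 0 ord0, \row_i x 0 (lift ord0 i)).

Lemma cons_rV0 n (p : measurableTypeR R * 'rV[R]_n) : cons_rV p 0 ord0 = p.1.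
Proof. by rewrite mxE unlift_none. Qed.

Lemma cons_rVS n (p : measurableTypeR R * 'rV[R]_n) (i : 'I_n) :
  cons_rV p 0 (lift ord0 i) = p.2 0 i.
Proof. by rewrite mxE liftK. Qed.

Lemma cons_rVK n : cancel (@cons_rV n) (@uncons_rV n).
Proof.
move=> p; rewrite /uncons_rV cons_rV0 [RHS]surjective_pairing; congr pair.
by apply/rowP => i; rewrite mxE cons_rVS.
Qed.

Lemma measurable_cons_rV n : measurable_fun setT (@cons_rV n).
Proof.
apply: measurable_fun_rV => i; have [j ->|->] := unliftP ord0 i.
  rewrite (_ : _ \o _ = (fun x : 'rV[R]_n => x 0 j) \o snd); last first.
    by apply/funext => p /=; rewrite cons_rVS.
  by apply: measurableT_comp; [exact: measurable_coord|exact: measurable_snd].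
rewrite (_ : _ \o _ = fst); first exact: measurable_fst.
by apply/funext => p /=; rewrite cons_rV0.
Qed.

Lemma measurable_uncons_rV n : measurable_fun setT (@uncons_rV n).
Proof.
apply: measurable_fun_pair; first exact: measurable_coord.
apply: measurable_fun_rV => i.
rewrite (_ : _ \o _ = fun x : 'rV[R]_n.+1 => x 0 (lift ord0 i)).
  exact: measurable_coord.
by apply/funext => x /=; rewrite mxE.
Qed.

Section step.
Variables (n : nat) (mu : {sigma_finite_measure set 'rV[R]_n -> \bar R}).

Definition lebesgue_rV_step : set 'rV[R]_n.+1 -> \bar R :=
  pushforward (@lebesgue_measure R \x mu)%E (@cons_rV n).

Let step0 : lebesgue_rV_step set0 = 0%E.
Proof. by rewrite /lebesgue_rV_step /pushforward preimage_set0 measure0. Qed.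

Let step_ge0 A : (0 <= lebesgue_rV_step A)%E.
Proof. exact: (measure_ge0 (@lebesgue_measure R \x mu)%E). Qed.

Let step_sigma_additive : semi_sigma_additive lebesgue_rV_step.
Proof.
move=> F mF tF mUF; rewrite /lebesgue_rV_step /pushforward preimage_bigcup.
have mp B : measurable B -> measurable (@cons_rV n @^-1` B).
  by move=> mB; rewrite -[X in measurable X]setTI; exact: measurable_cons_rV.
apply: measure_semi_sigma_additive.
- by move=> i; exact: mp.
- apply/trivIsetP => /= i j _ _ ij; rewrite -preimage_setI.
  by move/trivIsetP : tF => /(_ _ _ _ _ ij) ->//; rewrite preimage_set0.
- by rewrite -preimage_bigcup; exact: mp.
Qed.

HB.instance Definition _ := isMeasure.Build _ _ _ lebesgue_rV_step
  step0 step_ge0 step_sigma_additive.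

Let step_sigma_finite : sigma_finite setT lebesgue_rV_step.
Proof.
have [F TF Foo] : sigma_finite setT (@lebesgue_measure R \x mu)%E.
  have /sigma_finiteP[F [TF ndF Foo]] := sigma_finiteT (@lebesgue_measure R).
  have /sigma_finiteP[G [TG ndG Goo]] := sigma_finiteT mu.
  exists (fun i => F i `*` G i).
    rewrite -setXTT TF TG predeqE => -[x y]; split.
      move=> [/= [i _ Fix] [j _ Gjy]]; exists (maxn i j) => //; split.
      - by move: x Fix; exact/subsetPset/ndF/leq_maxl.
      - by move: y Gjy; exact/subsetPset/ndG/leq_maxr.
    by move=> [i _ []/= ? ?]; split; exists i.
  move=> i; have [? ?] := Foo i; have [? ?] := Goo i.
  split; first exact: measurableX.
  by rewrite product_measure1E// lte_mul_pinfty// ge0_fin_numE.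
exists (fun i => @uncons_rV n @^-1` F i).
  by rewrite -preimage_bigcup -TF preimage_setT.
move=> i; have [mF Fi] := Foo i; split.
  by rewrite -[X in measurable X]setTI; exact: measurable_uncons_rV.
rewrite /lebesgue_rV_step /pushforward -comp_preimage.
by rewrite (_ : _ \o _ = id) ?preimage_id//; apply/funext/cons_rVK.
Qed.

HB.instance Definition _ := Measure_isSigmaFinite.Build _ _ _
  lebesgue_rV_step step_sigma_finite.

End step.

(* Lebesgue measure on R^n, as the n-fold product of [lebesgue_measure]. *)
Fixpoint lebesgue_rV n : {sigma_finite_measure set 'rV[R]_n -> \bar R} :=
  if n is m.+1 then lebesgue_rV_step (lebesgue_rV m) else dirac (0 : 'rV[R]_0).

End lebesgue_rV.

Section linear_span.
Context {R : realType} {X : Type}.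
Implicit Type V : set (X -> R).

Definition fspan (A : set (X -> R)) : set (X -> R) :=
  [set f | exists m (c : 'I_m -> R) (a : 'I_m -> X -> R),
    (forall i, A (a i)) /\ f = (fun x => \sum_(i < m) c i * a i x)].

Definition is_basis V n (b : 'I_n -> X -> R) : Prop :=
  V = fspan (range b) /\
  forall c : 'I_n -> R, (forall x, \sum_(i < n) c i * b i x = 0) ->
    forall i, c i = 0.

(* Junk value 0 if [V] is not a finite-dimensional subspace. *)
Definition fdim V : nat :=
  xget 0%N [set n | exists b : 'I_n -> X -> R, is_basis V b].

End linear_span.

(* A simplex in R^d is represented by the finite set of its vertices; its
   subsimplices are then the nonempty subsets of this set. *)
Section simplices.
Context {R : realType} {d : nat}.
Implicit Types F K : {fset 'rV[R]_d}.

(* The vertices are listed in the (arbitrary) order of the enumeration of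
   [F]; nothing below depends on this order. *)
Definition edge_mx F : 'M[R]_((#|` F|).-1, d) :=
  \matrix_(i < (#|` F|).-1) (F`_i.+1 - F`_0).

Definition affine_indep F : bool := row_free (edge_mx F).

Definition codim F : nat := (d.+1 - #|` F|)%N.

Definition subsimplex F K : bool := (F != fset0) && (F `<=` K)%fset.

Definition conv_hull F : set 'rV[R]_d :=
  [set x | exists c : F -> R, [/\ forall v, 0 <= c v, \sum_v c v = 1
    & x = \sum_v c v *: val v]].

(* The barycentric coordinates of [x] with respect to the vertices of [F]:
   unique if [F] is affinely independent and [x] is in its affine span. *)
Definition bary F (x : 'rV[R]_d) : {ffun F -> R} :=
  xget [ffun=> 0] [set c : {ffun F -> R} |
    \sum_v c v = 1 /\ \sum_v c v *: val v = x].

Definition std_simplex m : set 'rV[R]_m :=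
  [set t | (forall i, 0 <= t 0 i) /\ \sum_i t 0 i <= 1].

(* Integral over [F] for the surface measure of dimension #|F| - 1, through the
   affine parametrization of [F] by the standard simplex, with Gram factor. *)
Definition simplex_int F (f : 'rV[R]_d -> R) : R :=
  Num.sqrt (\det (edge_mx F *m (edge_mx F)^T)) *
  \int[lebesgue_rV (#|` F|).-1]_(t in @std_simplex (#|` F|).-1)
    f (F`_0 + t *m edge_mx F).

Definition simplex_vol F : R := simplex_int F (fun=> 1).

End simplices.

Section degrees_of_freedom.
Context {R : realType} {d : nat}.
Variables r k : nat.
Implicit Types (F K : {fset 'rV[R]_d}) (u v : 'rV[R]_d -> R).

(* Polynomials on a d-simplex are identified with polynomials on R^d. *)
Definition polys : set ('rV[R]_d -> R) :=
  fspan [set f | exists a : 'I_d -> nat, (\sum_i a i <= k)%N /\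
    f = (fun x : 'rV[R]_d => \prod_i x 0 i ^+ a i)].

(* The largest n for codimension [s]: 2^(s-1) r, and 0 if s = 0. *)
Definition max_order (s : nat) : nat :=
  (if s is s'.+1 then 2 ^ s' * r else 0)%N.

Definition admissible F (n : nat) (sigma : F -> nat) : Prop :=
  (\sum_v sigma v + n = k)%N /\
  forall S : {set F}, (0 < #|S| < #|` F|)%N ->
    (2 ^ (#|S| + codim F - 1) * r < \sum_(v in S) sigma v + n)%N.

(* The space B_{F,n,k}; functions on [F] are represented by their extension
   by zero to R^d. *)
Definition bubble F (n : nat) : set ('rV[R]_d -> R) :=
  fspan [set f | exists sigma : F -> nat, admissible n sigma /\
    f = (fun x => \prod_v bary F x v ^+ sigma v) \_ (conv_hull F)].

(* The rows of [N] are the directions of differentiation. *)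
Definition normal_derive s (N : 'M[R]_(s, d)) (theta : 'I_s -> nat) u :
    'rV[R]_d -> R :=
  foldr (fun i f => iter (theta i) (fun g => 'D_(row i N) g) f) u (enum 'I_s).

Variable normal : forall F, 'M[R]_(codim F, d).

Definition dof F (theta : 'I_(codim F) -> nat) v u : R :=
  let Du := normal_derive (normal F) theta u in
  if #|` F| == 1%N then Du F`_0 * v F`_0
  else (simplex_vol F)^-1 * simplex_int F (fun x => Du x * v x).

(* [v] runs through the whole space B_{F,n,k} or, equivalently by linearity,
   through a basis of it; [dof_count] counts basis elements. *)
Definition dofs_eq F u1 u2 : Prop :=
  forall theta : 'I_(codim F) -> nat,
    (\sum_i theta i <= max_order (codim F))%N ->
    forall v, bubble F (\sum_i theta i)%N v ->
      dof theta v u1 = dof theta v u2.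

Definition dofs_vanish F u : Prop :=
  forall theta : 'I_(codim F) -> nat,
    (\sum_i theta i <= max_order (codim F))%N ->
    forall v, bubble F (\sum_i theta i)%N v -> dof theta v u = 0.

Definition dof_count K : nat :=
  (\sum_(F <- fpowerset K | subsimplex F K)
    \sum_(theta : {ffun 'I_(codim F) -> 'I_(max_order (codim F)).+1}
        | \sum_i theta i <= max_order (codim F))
      fdim (bubble F (\sum_i theta i)))%N.

Definition unisolvent K : Prop :=
  dof_count K = fdim polys /\
  forall u, polys u -> (forall F, subsimplex F K -> dofs_vanish F u) ->
    u = (fun=> 0).

End degrees_of_freedom.

Section triangulations.
Context {R : realType} {d : nat}.
Implicit Types (T : set {fset 'rV[R]_d}) (Omega : set 'rV[R]_d).

Definition is_domain Omega : Prop :=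
  [/\ open Omega, connected Omega & Omega !=set0].

(* For a finite [T] the covering conditions amount to the closure of [Omega]
   being the union of the simplices. *)
Record triangulation Omega T : Prop := {
  triangulation_simplex : forall K, T K -> #|` K| = d.+1 /\ affine_indep K ;
  triangulation_sub : forall K, T K -> conv_hull K `<=` closure Omega ;
  triangulation_cover : Omega `<=` \bigcup_(K in T) conv_hull K ;
  triangulation_locally_finite : forall x, Omega x -> exists2 U, nbhs x U &
    finite_set [set K | T K /\ conv_hull K `&` U !=set0] ;
  (* [F] is empty if the two simplices are disjoint *)
  triangulation_conforming : forall K1 K2, T K1 -> T K2 ->
    exists F, [/\ (F `<=` K1)%fset, (F `<=` K2)%fset
      & conv_hull K1 `&` conv_hull K2 = conv_hull F] }.

Definition normal_frames T
    (normal : forall F : {fset 'rV[R]_d}, 'M[R]_(codim F, d)) : Prop :=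
  forall K F, T K -> subsimplex F K ->
    normal F *m (normal F)^T = 1%:M /\ edge_mx F *m (normal F)^T = 0.

Definition L2 Omega : set ('rV[R]_d -> R) :=
  [set u : 'rV[R]_d -> R | measurable_fun Omega u /\
    (\int[lebesgue_rV d]_(x in Omega) (`|u x| ^+ 2)%:E < +oo)%E].

Definition fe_space (r k : nat) normal T Omega : set ('rV[R]_d -> R) :=
  [set u | L2 Omega u /\
    exists p : {fset 'rV[R]_d} -> 'rV[R]_d -> R,
      (forall K, T K -> polys k (p K) /\
        u = p K %[ae lebesgue_rV d in conv_hull K]) /\
      (forall F K1 K2, T K1 -> T K2 -> subsimplex F K1 -> subsimplex F K2 ->
        (#|` F| <= d)%N -> dofs_eq r k normal F (p K1) (p K2))].

(* C^r on an open set, through iterated partial derivatives. *)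
Fixpoint Cr (r : nat) Omega (g : 'rV[R]_d -> R) : Prop :=
  (forall x, Omega x -> {for x, continuous g}) /\
  if r is r'.+1 then
    forall i : 'I_d,
      (forall x, Omega x -> derivable g x 'e_i) /\
      Cr r' Omega ('D_('e_i) g)
  else True.

Definition Cr_ae (r : nat) Omega : set ('rV[R]_d -> R) :=
  [set u | exists g, Cr r Omega g /\
    u = g %[ae lebesgue_rV d in Omega]].

End triangulations.

(* Main.v *)
Require Import Defs.
From HB Require Import structures.
From mathcomp Require Import all_boot all_order all_algebra finmap.
From mathcomp Require Import all_classical all_reals all_analysis.
From mathcomp Require Import zify ring lra.
Set Implicit Arguments.
Unset Strict Implicit.
Unset Printing Implicit Defensive.
Import Order.TTheory GRing.Theory Num.Theory.
Import numFieldNormedType.Exports.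
Local Open Scope classical_set_scope.
Local Open Scope ring_scope.

(* Let [w] be a polynomial of degree at most [k] all of whose degrees of freedom
   vanish on the subsimplices of [F].  By induction on the dimension, all
   derivatives of [w] of order at most [max_order r (codim E)] vanish on every
   proper subsimplex [E] of [F].  For [n = |theta|] this forces the expansion of
   [D^theta w] on [F] in barycentric monomials to involve only admissible
   exponents, so that [D^theta w] itself lies in [bubble F n]; testing it against
   itself shows that it vanishes on [F], and together with derivatives tangent to
   [F] this gives all derivatives of order at most [max_order r (codim F)].

   With [F] the whole simplex this is the injectivity part of unisolvence; with
   [w] the difference of two pieces and [F] a common face it makes the pieces
   agree to order [r], and functions that are piecewise polynomial on a locally
   finite family of closed sets with such agreement are of class [C^r].

   For the count, an exponent [alpha] with [|alpha| = k] on the vertices of [K]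
   is assigned to the subsimplex [F] whose set of opposite vertices [G] is maximal
   among the proper subsets of [K] with [alpha(G) <= max_order r #|G|].  Such sets
   are closed under union since [2^(s-1) r + 2^(t-1) r <= 2^(max(s,t)) r], so [F]
   is unique, and [alpha] splits into [theta] off [F] and an admissible exponent
   on [F]. *)

(** * Univariate polynomials and their values *)

Section poly_facts.
Context {R : realType}.

(** A nonzero [p] has fewer than [size p] roots, but the integers from 1 to [size p] would all be
    roots. *)
Lemma poly_eq0_pos (p : {poly R}) : (forall t, 0 < t -> p.[t] = 0) -> p = 0.
Proof.
move=> p0; apply/eqP/negPn/negP => pn0.
pose s := [seq i.+1%:R : R | i <- iota 0 (size p)].
have us : uniq s.
  rewrite map_inj_uniq ?iota_uniq// => i j /eqP.
  by rewrite eqr_nat eqSS => /eqP.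
have rs : all (root p) s.
  by apply/allP => x /mapP[i _ ->]; rewrite /root p0// ltr0Sn.
by have := max_poly_roots pn0 rs us; rewrite size_map size_iota ltnn.
Qed.

Lemma poly_eq_fun (p q : {poly R}) : (forall t, p.[t] = q.[t]) -> p = q.
Proof.
move=> pq; apply/eqP; rewrite -subr_eq0; apply/eqP/poly_eq0_pos => t _.
by rewrite hornerD hornerN pq subrr.
Qed.

End poly_facts.

(** * Monomials, base expansions and independence of monomials *)

Section monomials.
Context {R : realType} {I : finType}.

Definition monom (e : I -> nat) (y : I -> R) : R := \prod_i y i ^+ e i.

Lemma monomZ e a (y : I -> R) : monom e (fun i => a * y i) = a ^+ (\sum_i e i) * monom e y.
Proof.
rewrite /monom -prodrXr -big_split /=; apply: eq_bigr => i _.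
by rewrite exprMn.
Qed.

End monomials.

(** Reduction modulo [B] isolates the lowest digit; cancelling it and a factor [B] leaves the
    remaining digits to the induction. *)
Lemma digits_inj n B (a b : 'I_n -> nat) :
  (forall i, a i < B)%N -> (forall i, b i < B)%N ->
  (\sum_(i < n) a i * B ^ i = \sum_(i < n) b i * B ^ i)%N -> a =1 b.
Proof.
elim: n a b => [|n IH] a b aB bB; first by move=> _ [].
have E c : (\sum_(i < n.+1) c i * B ^ i = c ord0 +
    (\sum_(i < n) c (lift ord0 i) * B ^ i) * B)%N.
  rewrite big_ord_recl expn0 muln1; congr addn.
  rewrite big_distrl /=; apply: eq_bigr => i _.
  by rewrite -mulnA -expnSr /bump leq0n.
rewrite !E => H.
have H0 : a ord0 = b ord0.
  have := congr1 (modn^~ B) H.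
  by rewrite ![(_ + _ * B)%N]addnC !modnMDl !modn_small.
have B0 : (0 < B)%N by exact: leq_ltn_trans (aB ord0).
have H1 : (\sum_(i < n) a (lift ord0 i) * B ^ i =
    \sum_(i < n) b (lift ord0 i) * B ^ i)%N.
  by move: H; rewrite H0 => /addnI/eqP; rewrite eqn_pmul2r// => /eqP.
move=> i; have [j ->|->] := unliftP ord0 i => //.
exact: (IH (fun i => a (lift ord0 i)) (fun i => b (lift ord0 i))).
Qed.

Section monomial_independence.
Context {R : realType} {I J : finType}.

(* Kronecker's substitution [y_i = t ^ (B ^ i)] sends distinct monomials to
   distinct powers of [t]. *)
Lemma monom_free (P : pred J) (e : J -> I -> nat) (c : J -> R) :
  (forall j j', P j -> P j' -> e j =1 e j' -> j = j') ->
  (forall y : I -> R, (forall i, 0 < y i) -> \sum_(j | P j) c j * monom (e j) y = 0) ->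
  forall j, P j -> c j = 0.
Proof.
move=> einj c0 j Pj.
(* [B] exceeds every exponent, so each [e j] is the digit sequence of [w j] in base [B]. *)
pose B := (\max_j \max_i e j i).+1.
have eB j' i : (e j' i < B)%N.
  rewrite ltnS; apply: leq_trans (leq_bigmax j').
  exact: (leq_bigmax (F := fun i => e j' i)).
pose w j := (\sum_i e j i * B ^ enum_rank i)%N.
have wE j' : w j' = (\sum_(i < #|I|) e j' (enum_val i) * B ^ i)%N.
  rewrite /w (reindex (@enum_val I I)) /=; last exact/onW_bij/enum_val_bij.
  by apply: eq_bigr => i _; rewrite enum_valK.
have winj j1 j2 : P j1 -> P j2 -> w j1 = w j2 -> j1 = j2.
  move=> P1 P2; rewrite !wE => w12.
  apply: einj => // i.
  have := digits_inj (fun i => eB j1 (enum_val i)) (fun i => eB j2 (enum_val i)) w12.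
  by move=> /(_ (enum_rank i)); rewrite enum_rankK.
pose Q : {poly R} := \sum_(j | P j) c j *: 'X^(w j).
have Q0 : Q = 0.
  apply: poly_eq0_pos => t t0.
  have := c0 (fun i => t ^+ (B ^ enum_rank i)).
  have -> : \sum_(j0 | P j0) c j0 * monom (e j0) (fun i => t ^+ (B ^ enum_rank i)) =
     Q.[t].
    rewrite /Q horner_sum; apply: eq_bigr => j' _.
    rewrite hornerZ hornerXn /w /monom -prodrXr; congr (_ * _).
    by apply: eq_bigr => i _; rewrite -exprM mulnC.
  by apply => i; exact: exprn_gt0.
have := congr1 (fun p : {poly R} => p`_(w j)) Q0.
rewrite coef0 /Q coef_sum (bigD1 j)//= coefZ coefXn eqxx mulr1 big1 ?addr0//.
move=> j' /andP[Pj' jj']; rewrite coefZ coefXn.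
case: eqP => [wj|]; last by rewrite mulr0.
by move/eqP: jj'; case; apply: winj.
Qed.

End monomial_independence.

(** * Finite spans of functions and their dimension *)

Section spans.
Context {R : realType} {X : Type}.
Implicit Types (A B : set (X -> R)) (f g : X -> R).

Lemma fspan_incl A f : A f -> fspan A f.
Proof.
move=> Af; exists 1%N, (fun=> 1), (fun=> f); split=> //.
by apply/funext => x; rewrite big_ord_recl big_ord0 mul1r addr0.
Qed.

Lemma fspan0 A : fspan A (fun=> 0).
Proof.
exists 0%N, (fun=> 0), (fun _ _ => 0); split; first by case.
by apply/funext => x; rewrite big_ord0.
Qed.

Lemma fspanZ A f a : fspan A f -> fspan A (fun x => a * f x).
Proof.
move=> [m [c [b [Ab ->]]]]; exists m, (fun i => a * c i), b; split=> //.
by apply/funext => x; rewrite mulr_sumr; apply: eq_bigr => i _; rewrite mulrA.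
Qed.

Lemma fspanD A f g : fspan A f -> fspan A g -> fspan A (fun x => f x + g x).
Proof.
move=> [m [c [b [Ab ->]]]] [n [c' [b' [Ab' ->]]]].
exists (m + n)%N,
  (fun i => match fintype.split i with inl j => c j | inr j => c' j end),
  (fun i => match fintype.split i with inl j => b j | inr j => b' j end).
split; first by move=> i; case: fintype.split.
apply/funext => x; rewrite big_split_ord; congr (_ + _); apply: eq_bigr => i _.
  by rewrite (unsplitK (inl i)).
by rewrite (unsplitK (inr i)).
Qed.

Lemma fspan_sum A (J : finType) (P : pred J) (f : J -> X -> R) :
  (forall j, P j -> fspan A (f j)) -> fspan A (fun x => \sum_(j | P j) f j x).
Proof.
move=> Af.
have -> : (fun x => \sum_(j | P j) f j x) = \sum_(j | P j) f j.
  by apply/funext => x; rewrite fct_sumE.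
elim/big_rec : _ => [|j g Pj Ag]; first exact: fspan0.
by apply: (@fspanD _ (f j) g) => //; exact: Af.
Qed.

Lemma fspan_ind A B f : (forall g, A g -> fspan B g) -> fspan A f -> fspan B f.
Proof.
move=> AB [m [c [b [Ab ->]]]].
by apply: fspan_sum => i _; apply: fspanZ; exact: AB.
Qed.

Lemma fspan_fin (J : finType) (P : pred J) (b : J -> X -> R) f :
  fspan [set b j | j in [set j | P j]] f ->
  exists c : J -> R, f = (fun x => \sum_(j | P j) c j * b j x).
Proof.
move=> [m [c [a [Ab ->]]]].
have /choice[h hP] : forall i : 'I_m, exists j, P j /\ b j = a i.
  by move=> i; have [j Pj <-] := Ab i; exists j.
exists (fun j => \sum_(i | h i == j) c i); apply/funext => x.
rewrite (partition_big h P) /=; last by move=> i _; have [] := hP i.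
apply: eq_bigr => j Pj; rewrite mulr_suml; apply: eq_bigr => i /eqP <-.
by have [_ ->] := hP i.
Qed.

(** Expressing each basis in the other gives an [n] by [m] matrix with a right inverse, whence the
    bound. Exchanging the bases gives equality. *)
Lemma is_basis_uniq (V : set (X -> R)) n m (b : 'I_n -> X -> R) (b' : 'I_m -> X -> R) :
  is_basis V b -> is_basis V b' -> (n <= m)%N.
Proof.
move=> [Vb fb] [Vb' fb'].
have rb (l : nat) (a : 'I_l -> X -> R) : range a = [set a j | j in [set j : 'I_l | xpredT j]].
  by apply/seteqP; split => [_ [x _ <-]|_ [x _ <-]]; exists x.
have /choice[A AP] i : exists c : 'I_m -> R, b i = (fun x => \sum_j c j * b' j x).
  have : fspan (range b') (b i).
    by rewrite -Vb' Vb; apply: fspan_incl; exists i.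
  by rewrite rb => /fspan_fin.
have /choice[A' AP'] i : exists c : 'I_n -> R, b' i = (fun x => \sum_j c j * b j x).
  have : fspan (range b) (b' i).
    by rewrite -Vb Vb'; apply: fspan_incl; exists i.
  by rewrite rb => /fspan_fin.
pose M := \matrix_(i, j) A i j; pose M' := \matrix_(i, j) A' i j.
have MM : M *m M' = 1%:M.
  apply/matrixP => i k; rewrite !mxE; apply/eqP; rewrite -subr_eq0; apply/eqP.
  move: k; apply: (fb (fun k => \sum_j M i j * M' j k - (i == k)%:R)) => x.
  under eq_bigr do rewrite mulrBl mulr_suml.
  rewrite sumrB exchange_big /=.
  apply/eqP; rewrite subr_eq0; apply/eqP.
  transitivity (b i x); last first.
    rewrite (bigD1 i)//= eqxx mul1r big1 ?addr0// => j /negPf.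
    by rewrite eq_sym => ->; rewrite mul0r.
  rewrite AP; apply: eq_bigr => j _; rewrite AP' mulr_sumr.
  by apply: eq_bigr => k _; rewrite !mxE mulrA.
have := mulmx1_min MM; exact.
Qed.

Lemma fdim_basis (V : set (X -> R)) n (b : 'I_n -> X -> R) : is_basis V b -> fdim V = n.
Proof.
move=> Vb; rewrite /fdim.
have : [set n | exists b : 'I_n -> X -> R, is_basis V b] n by exists b.
case: xgetP => [m -> [b' Vb'] _|/(_ n) //].
by apply/eqP; rewrite eqn_leq (is_basis_uniq Vb' Vb) (is_basis_uniq Vb Vb').
Qed.

(** Enumerating [P] by ordinals produces a basis as [is_basis] wants it, so that dimensions become
    numbers of exponents. *)
Lemma fdim_fspan (J : finType) (P : pred J) (b : J -> X -> R) :
  (forall c : J -> R, (forall x, \sum_(j | P j) c j * b j x = 0) ->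
     forall j, P j -> c j = 0) ->
  fdim (fspan [set b j | j in [set j | P j]]) = #|P|.
Proof.
move=> bfree; apply: (fdim_basis (b := fun i : 'I_#|P| => b (enum_val i))).
split.
  congr fspan; apply/seteqP; split => [_ [j /= Pj <-]|_ [i _ <-]]; last first.
    by exists (enum_val i) => //=; exact: (enum_valP i).
  by exists (enum_rank_in Pj j) => //; rewrite enum_rankK_in.
move=> c c0 i.
have Pi := enum_valP i.
pose c' j := c (enum_rank_in Pi j).
have : c' (enum_val i) = 0.
  apply: bfree => // x; rewrite -[RHS](c0 x) (big_enum_val (A := P)) /=.
  by apply: eq_bigr => l _; rewrite /c' enum_valK_in.
by rewrite /c' enum_valK_in.
Qed.

End spans.

(** * Polynomial functions of several variables and their directional derivatives *)

Section polynomial_functions.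
Context {R : realType}.

(** The index bounds the degree. Generation by constants, multiplication by a coordinate and sums
    turns the differentiation rules below into inductions with three cases. *)
Inductive polyfun d : nat -> ('rV[R]_d -> R) -> Prop :=
| polyfun_cst n c : polyfun n (fun=> c)
| polyfun_coordM n i f : polyfun n f -> polyfun n.+1 (fun x => x 0 i * f x)
| polyfunD n f g : polyfun n f -> polyfun n g -> polyfun n (fun x => f x + g x).

Section fixed_dim.
Variable d : nat.
Implicit Types (f g : 'rV[R]_d -> R) (x v w : 'rV[R]_d).

Lemma polyfun_ext n f g : f =1 g -> polyfun n g -> polyfun n f.
Proof. by move=> /funext ->. Qed.

Lemma polyfun_le n m f : (n <= m)%N -> polyfun n f -> polyfun m f.
Proof.
move=> nm pf; elim: pf m nm => {n f} [n c|n i f _ IH|n f g _ IHf _ IHg] m nm.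
- exact: polyfun_cst.
- by case: m nm => // m nm; apply: polyfun_coordM; exact: IH.
- by apply: polyfunD; [exact: IHf|exact: IHg].
Qed.

Lemma polyfunZ n a f : polyfun n f -> polyfun n (fun x => a * f x).
Proof.
elim => {n f} [n c|n i f _ IH|n f g _ IHf _ IHg].
- exact: polyfun_cst.
- under eq_fun do rewrite mulrCA; exact: polyfun_coordM.
- under eq_fun do rewrite mulrDr; exact: polyfunD.
Qed.

Lemma polyfunB n f g : polyfun n f -> polyfun n g -> polyfun n (fun x => f x - g x).
Proof.
move=> pf /(polyfunZ (-1)) pg.
by under eq_fun do rewrite -mulN1r; exact: polyfunD.
Qed.

Lemma polyfun_sum n (J : finType) (P : pred J) (f : J -> 'rV[R]_d -> R) :
  (forall j, P j -> polyfun n (f j)) -> polyfun n (fun x => \sum_(j | P j) f j x).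
Proof.
move=> pf.
have -> : (fun x => \sum_(j | P j) f j x) = \sum_(j | P j) f j.
  by apply/funext => x; rewrite fct_sumE.
elim/big_rec : _ => [|j g Pj Ag]; first exact: polyfun_cst.
by apply: (@polyfunD _ _ (f j) g) => //; exact: pf.
Qed.

Lemma polyfun_monom (a : 'I_d -> nat) : polyfun (\sum_i a i) (fun x => \prod_i x 0 i ^+ a i).
Proof.
elim: (index_enum _) => [|i s IH].
  by rewrite big_nil; under eq_fun do rewrite big_nil; exact: polyfun_cst.
have -> : (fun x : 'rV[R]_d => \prod_(j <- i :: s) x 0 j ^+ a j) =
    (fun x => x 0 i ^+ a i * \prod_(j <- s) x 0 j ^+ a j).
  by apply/funext => x; rewrite big_cons.
rewrite big_cons; elim: (a i) => [|j IHj].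
  by apply: polyfun_ext IH => x; rewrite expr0 mul1r.
rewrite addSn; apply: (polyfun_ext _ (polyfun_coordM i IHj)) => x.
by rewrite exprS -mulrA.
Qed.

Lemma polys_polyfun k f : polys k f -> polyfun k f.
Proof.
move=> [m [c [b [Ab ->]]]]; apply: polyfun_sum => i _; apply: polyfunZ.
by have [a [ak ->]] := Ab i; exact: polyfun_le (polyfun_monom a).
Qed.

(* A named constant: the notation ['D_v f] stands for an abstraction, which
   resists rewriting. *)
Definition ddir v f : 'rV[R]_d -> R := 'D_v f.

Lemma ddir_cst v (c : R) : ddir v (fun=> c) = fun=> 0.
Proof. by apply/funext => x; exact: derive_cst. Qed.

Lemma is_derive_coord i x v : is_derive x v (fun y : 'rV[R]_d => y 0 i) (v 0 i).
Proof.
have cv : (fun h : R => h^-1 *: (((fun y : 'rV[R]_d => y 0 i) \o shift x) (h *: v) - x 0 i))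
    @ 0^' --> v 0 i.
  apply: cvg_near_cst; near=> h.
  have h0 : h != 0 by near: h; exact: nbhs_dnbhs_neq.
  by rewrite /= !mxE addrK [_ *: _]mulrA mulVf// mul1r.
by apply: DeriveDef; [apply/cvg_ex; exists (v 0 i)|exact: cvg_lim cv].
Unshelve. all: by end_near. Qed.

Lemma polyfun_derivable n f x v : polyfun n f -> derivable f x v.
Proof.
elim => {n f} [n c|n i f _ IH|n f g _ IHf _ IHg].
- exact: derivable_cst.
- by apply: derivableM => //; have [] := is_derive_coord i x v.
- exact: derivableD.
Qed.

Lemma derive_coordM n i f x v : polyfun n f ->
  ddir v (fun y : 'rV[R]_d => y 0 i * f y) x = v 0 i * f x + x 0 i * ddir v f x.
Proof.
move=> pf; have [dc Dc] := is_derive_coord i x v.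
rewrite /ddir (deriveM dc (polyfun_derivable pf)) Dc addrC.
by congr (_ + _); exact: mulrC.
Qed.

Lemma derive_polyfunD n f g x v : polyfun n f -> polyfun n g ->
  ddir v (fun y => f y + g y) x = ddir v f x + ddir v g x.
Proof.
move=> pf pg.
by apply: deriveD; [exact: polyfun_derivable pf|exact: polyfun_derivable pg].
Qed.

Lemma derive_polyfunB n f g x v : polyfun n f -> polyfun n g ->
  ddir v (fun y => f y - g y) x = ddir v f x - ddir v g x.
Proof.
move=> pf pg.
by apply: deriveB; [exact: polyfun_derivable pf|exact: polyfun_derivable pg].
Qed.

Lemma derive_polyfun0 f x v : polyfun 0 f -> ddir v f x = 0.
Proof.
move=> pf; have [n n0] : {n | n = 0%N} by exists 0%N.
rewrite -n0 in pf; elim: pf n0 => {n f} [n c _|//|n f g pf IHf pg IHg n0].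
  by rewrite ddir_cst.
by rewrite (derive_polyfunD _ _ pf pg) IHf// IHg// addr0.
Qed.

Lemma polyfun_derive n f v : polyfun n f -> polyfun n.-1 (ddir v f).
Proof.
elim => {n f} [n c|n i f pf IH|n f g pf IHf pg IHg].
- by rewrite ddir_cst; exact: polyfun_cst.
- rewrite (_ : ddir v _ = fun x => v 0 i * f x + x 0 i * ddir v f x); last first.
    by apply/funext => x; exact: derive_coordM pf.
  apply: polyfunD; first exact: polyfunZ.
  (* For [n = 0] the truncated [n.-1] is again 0 and multiplication by a coordinate would exceed the
     bound; there the derivative of [f] is zero. *)
  case: n pf IH => [|n] pf IH; last exact: polyfun_coordM.
  apply: polyfun_ext (polyfun_cst _ 0 0) => x.
  by rewrite derive_polyfun0 ?mulr0.
- rewrite (_ : ddir v _ = fun x => ddir v f x + ddir v g x); first exact: polyfunD.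
  by apply/funext => x; exact: derive_polyfunD pf pg.
Qed.

Lemma polyfun_deriveT n f v : polyfun n f -> polyfun n (ddir v f).
Proof. by move=> /(polyfun_derive v); apply: polyfun_le; exact: leq_pred. Qed.

(** In the product case two applications of the product rule give three terms; exchanging [v] and
    [w] swaps the first two, and the induction hypothesis handles the third. *)
Lemma derive_comm n f v w : polyfun n f -> ddir v (ddir w f) = ddir w (ddir v f).
Proof.
elim => {n f} [n c|n i f pf IH|n f g pf IHf pg IHg].
- by rewrite !ddir_cst.
- have cM u : ddir u (fun y : 'rV[R]_d => y 0 i * f y) =
      (fun x => u 0 i * f x + x 0 i * ddir u f x).
    by apply/funext => x; exact: derive_coordM pf.
  rewrite !cM; apply/funext => x.
  have D2 (u1 u2 : 'rV[R]_d) : ddir u1 (fun x => u2 0 i * f x + x 0 i * ddir u2 f x) x =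
      u2 0 i * ddir u1 f x + (u1 0 i * ddir u2 f x + x 0 i * ddir u1 (ddir u2 f) x).
    rewrite (derive_polyfunD (n := n.+1)).
    - rewrite (derive_coordM _ _ _ (polyfun_deriveT u2 pf)); congr (_ + _).
      exact: (deriveZ _ (polyfun_derivable pf)).
    - by apply: polyfunZ; exact: polyfun_le pf.
    - by apply: polyfun_coordM; exact: polyfun_deriveT.
  by rewrite !D2 IH addrCA.
- have cD u : ddir u (fun y => f y + g y) = (fun x => ddir u f x + ddir u g x).
    by apply/funext => x; exact: derive_polyfunD pf pg.
  rewrite !cD; apply/funext => x.
  rewrite (derive_polyfunD x v (polyfun_deriveT w pf) (polyfun_deriveT w pg)).
  rewrite (derive_polyfunD x w (polyfun_deriveT v pf) (polyfun_deriveT v pg)).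
  by rewrite IHf IHg.
Qed.

Lemma derive_dirD n f v w x : polyfun n f -> ddir (v + w) f x = ddir v f x + ddir w f x.
Proof.
elim => {n f} [n c|n i f pf IH|n f g pf IHf pg IHg].
- by rewrite !ddir_cst addr0.
- by rewrite !(derive_coordM _ _ _ pf) IH !mxE; ring.
- by rewrite !(derive_polyfunD _ _ pf pg) IHf IHg; ring.
Qed.

Lemma derive_dirZ n f a v x : polyfun n f -> ddir (a *: v) f x = a * ddir v f x.
Proof.
elim => {n f} [n c|n i f pf IH|n f g pf IHf pg IHg].
- by rewrite !ddir_cst mulr0.
- by rewrite !(derive_coordM _ _ _ pf) IH !mxE; ring.
- by rewrite !(derive_polyfunD _ _ pf pg) IHf IHg; ring.
Qed.

Lemma derive_dir_sum n f (J : finType) (a : J -> R) (v : J -> 'rV[R]_d) x :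
  polyfun n f -> ddir (\sum_j a j *: v j) f x = \sum_j a j * ddir (v j) f x.
Proof.
move=> pf; elim/big_rec2 : _ => [|j y1 y2 _ <-].
  by rewrite -(scale0r 0) (derive_dirZ _ _ _ pf) mul0r.
by rewrite (derive_dirD _ _ _ pf) (derive_dirZ _ _ _ pf).
Qed.

(** Turns differentiation along a line into formal differentiation in [{poly R}], where coefficients
    can be compared. *)
Lemma polyfun_line n f x w : polyfun n f -> exists p : {poly R}, forall t,
  f (x + t *: w) = p.[t] /\ ddir w f (x + t *: w) = p^`().[t].
Proof.
elim => {n f} [n c|n i f pf [p Hp]|n f g pf [p Hp] pg [q Hq]].
- by exists c%:P => t; rewrite derivC horner0 hornerC ddir_cst.
- exists (((x 0 i)%:P + (w 0 i) *: 'X) * p) => t; have [H1 H2] := Hp t.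
  rewrite (derive_coordM _ _ _ pf) H1 H2 !mxE derivM derivD derivC derivZ derivX.
  by rewrite !hornerE; split; ring.
- exists (p + q) => t; have [H1 H2] := Hp t; have [H3 H4] := Hq t.
  by rewrite (derive_polyfunD _ _ pf pg) derivD !hornerD H1 H2 H3 H4.
Qed.

End fixed_dim.

Lemma polyfun_affine m d n (f : 'rV[R]_d -> R) (x0 : 'rV[R]_d) (A : 'M[R]_(m, d)) :
  polyfun n f -> polyfun n (fun t : 'rV[R]_m => f (x0 + t *m A)).
Proof.
elim => {n f} [n c|n i f pf IH|n f g pf IHf pg IHg].
- exact: polyfun_cst.
- rewrite (_ : (fun t => _) = fun t : 'rV[R]_m => x0 0 i * f (x0 + t *m A) +
      \sum_j A j i * (t 0 j * f (x0 + t *m A))).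
    apply: polyfunD; first by apply: polyfunZ; exact: polyfun_le IH.
    by apply: polyfun_sum => j _; apply: polyfunZ; exact: polyfun_coordM.
  apply/funext => t; rewrite !mxE mulrDl; congr (_ + _); rewrite mulr_suml.
  by apply: eq_bigr => j _; ring.
- exact: polyfunD.
Qed.

(** * Iterated directional derivatives *)

Section iterated_derivatives.
Variable d : nat.
Implicit Types (f g : 'rV[R]_d -> R) (ws : seq 'rV[R]_d).

Definition iter_derive ws f := foldr (@ddir d) f ws.

Lemma iter_derive_cat ws1 ws2 f :
  iter_derive (ws1 ++ ws2) f = iter_derive ws1 (iter_derive ws2 f).
Proof. exact: foldr_cat. Qed.

Lemma polyfun_iter_derive n f ws : polyfun n f -> polyfun (n - size ws) (iter_derive ws f).
Proof.
move=> pf; elim: ws => [|w ws IH] /=; first by rewrite subn0.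
by rewrite subnS; exact: polyfun_derive.
Qed.

Lemma polyfun_iter_deriveT n f ws : polyfun n f -> polyfun n (iter_derive ws f).
Proof. by move=> /(polyfun_iter_derive ws); apply: polyfun_le; exact: leq_subr. Qed.

Lemma iter_derive_perm n f ws ws' : polyfun n f -> perm_eq ws ws' ->
  iter_derive ws f = iter_derive ws' f.
Proof.
move=> pf; elim: ws ws' => [|w ws IH] ws' pe.
  by move: pe; rewrite perm_sym => /perm_nilP ->.
have /(nthP 0) : w \in ws' by rewrite -(perm_mem pe) mem_head.
move=> [i ilt wi].
have E : ws' = take i ws' ++ w :: drop i.+1 ws'.
  by rewrite -[LHS](cat_take_drop i) (drop_nth 0)// wi.
move: E pe {ilt wi}; move: (take i ws') (drop i.+1 ws') => s1 s2 -> pe.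
have {}pe : perm_eq ws (s1 ++ s2).
  by move: pe; rewrite perm_sym perm_catC /= perm_cons perm_catC perm_sym.
rewrite /= (IH _ pe) => {pe IH}.
elim: s1 => [//|v s1 /= <-]; apply: derive_comm.
by rewrite iter_derive_cat; apply: polyfun_iter_deriveT; exact: polyfun_iter_deriveT pf.
Qed.

Lemma iter_deriveB n f g ws : polyfun n f -> polyfun n g ->
  iter_derive ws (fun x => f x - g x) = (fun x => iter_derive ws f x - iter_derive ws g x).
Proof.
move=> pf pg; elim: ws => [//|w ws /= ->]; apply/funext => x.
by apply: (@derive_polyfunB _ n); exact: polyfun_iter_deriveT.
Qed.

Lemma iter_derive0 ws : iter_derive ws (fun _ : 'rV[R]_d => 0 : R) = (fun=> 0).
Proof. by elim: ws => [//|w ws /= ->]; apply/funext => x; rewrite ddir_cst. Qed.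

(** One [p] serves all orders: the polynomial that [polyfun_line] gives for the [j]-th derivative
    has the values of the [j]-th formal derivative of [p], hence equals it. *)
Lemma iter_derive_line n f x w : polyfun n f -> exists p : {poly R}, forall j t,
  iter_derive (nseq j w) f (x + t *: w) = p^`(j).[t].
Proof.
move=> pf; have [p Hp] := polyfun_line x w pf; exists p => j.
elim: j => [|j IH] t; first by rewrite derivn0; have [] := Hp t.
have [q Hq] := polyfun_line x w (polyfun_iter_deriveT (nseq j w) pf).
have qE : q = p^`(j) by apply: poly_eq_fun => s; rewrite -IH; have [->] := Hq s.
by have [_] := Hq t; rewrite qE.
Qed.

Lemma normal_derive_iter s (N : 'M[R]_(s, d)) (theta : 'I_s -> nat) f :
  normal_derive N theta f =
  iter_derive (flatten [seq nseq (theta i) (row i N) | i <- enum 'I_s]) f.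
Proof.
rewrite /normal_derive; elim: (enum 'I_s) => [//|i s' /= ->].
by rewrite iter_derive_cat; elim: (theta i) => [//|j /= ->].
Qed.

Lemma size_flatten_theta s (N : 'M[R]_(s, d)) (theta : 'I_s -> nat) :
  size (flatten [seq nseq (theta i) (row i N) | i <- enum 'I_s]) = \sum_i theta i.
Proof.
rewrite size_flatten /shape -map_comp sumnE big_map big_enum /=.
by apply: eq_bigr => i _; rewrite size_nseq.
Qed.

(** Since derivatives commute, a list of normal directions counts only through its multiplicities,
    which form a multi-index [theta]. *)
Lemma iter_derive_normal n s (N : 'M[R]_(s, d)) (l : seq 'I_s) f : polyfun n f ->
  iter_derive [seq row i N | i <- l] f = normal_derive N (fun i => count_mem i l) f.
Proof.
move=> pf; rewrite normal_derive_iter; apply: iter_derive_perm pf _.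
have -> : [seq nseq (count_mem i l) (row i N) | i <- enum 'I_s] =
    [seq [seq row j N | j <- s0] | s0 <- [seq nseq (count_mem i l) i | i <- enum 'I_s]].
  by elim: (enum _) => [|i s0 IHs] /=; first by [];
    rewrite IHs; congr cons; elim: (count_mem i l) => [|m IHm] /=; rewrite ?IHm.
rewrite -map_flatten; apply: perm_map; apply/allP => i _ /=.
rewrite count_flatten -map_comp sumnE big_map big_enum /= (bigD1 i)//=.
rewrite count_nseq /= eqxx mul1n big1 ?addn0// => j ji.
by rewrite count_nseq /= (negPf ji).
Qed.

Lemma sum_count_mem s (l : seq 'I_s) : (\sum_i count_mem i l = size l)%N.
Proof.
elim: l => [|i l IH] /=; first by rewrite big1.
rewrite big_split /= IH (bigD1 i)//= eqxx big1 ?addn0// => j /negPf.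
by rewrite eq_sym => ->.
Qed.

End iterated_derivatives.

End polynomial_functions.

(** * Homogeneous representation in barycentric coordinates *)

Section homogeneous_representation.
Context {R : realType} {I : finType}.

(** Values in ['I_n.+1] make the exponents a finite type; a total of [n] forces this bound
    anyway. *)
Definition homog n (s : {ffun I -> 'I_n.+1}) : bool := (\sum_i s i == n)%N.

Definition hmonom n (s : {ffun I -> 'I_n.+1}) : (I -> R) -> R :=
  monom (fun i => s i : nat).

Definition hspan n : set ((I -> R) -> R) :=
  fspan [set h | exists s : I -> nat, (\sum_i s i = n)%N /\ h = monom s].

Lemma hspanM n i h : hspan n h -> hspan n.+1 (fun l => l i * h l).
Proof.
move=> [m [c [b [bP ->]]]].
rewrite (_ : (fun l => _) = (fun l : I -> R => \sum_j c j * (l i * b j l))); last first.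
  by apply/funext => l; rewrite mulr_sumr; apply: eq_bigr => j _; rewrite mulrCA.
apply: fspan_sum => j _; apply: fspanZ; apply: fspan_incl.
have [s [sn ->]] := bP j; exists (fun x => s x + (x == i))%N; split.
  rewrite big_split /= sn -addn1; congr addn.
  by rewrite (bigD1 i)//= eqxx big1 // => x /negPf ->.
apply/funext => l; rewrite /monom; under [RHS]eq_bigr do rewrite exprD.
rewrite big_split /= mulrC; congr (_ * _); rewrite (bigD1 i)//= eqxx expr1 big1 ?mulr1//.
by move=> x /negPf ->; rewrite expr0.
Qed.

(** The coordinate sum is 1 where the representation is used, so its [n]-th power lifts a constant
    to degree [n]. *)
Lemma hspan_cst n c : hspan n (fun l => c * (\sum_i l i) ^+ n).
Proof.
apply: fspanZ; elim: n => [|n IH].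
  apply: fspan_incl; exists (fun=> 0)%N; split; first by rewrite big1.
  by apply/funext => l; rewrite expr0 /monom big1.
rewrite (_ : (fun l => _) = (fun l : I -> R => \sum_i l i * (\sum_j l j) ^+ n)).
  by apply: fspan_sum => i _; exact: hspanM.
by apply/funext => l; rewrite exprS mulr_suml.
Qed.

Lemma hspan_coef n h : hspan n h ->
  exists c : {ffun I -> 'I_n.+1} -> R,
    h = fun l => \sum_(s | @homog n s) c s * hmonom s l.
Proof.
move=> hh; apply: (fspan_fin (P := @homog n)
  (b := @hmonom n)).
apply: fspan_ind hh => g [s [sn ->]]; apply: fspan_incl.
have sle i : (s i <= n)%N by rewrite -sn (bigD1 i)//= leq_addr.
exists [ffun i => inord (s i)].
  by rewrite /= /homog -[X in _ == X]sn; apply/eqP; apply: eq_bigr => i _;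
    rewrite ffunE inordK ?ltnS ?sle.
by apply/funext => l; apply: eq_bigr => i _; rewrite ffunE inordK ?ltnS ?sle.
Qed.

(** Each Cartesian coordinate is a linear form in [l], so multiplication by it raises the
    homogeneous degree by one. *)
Lemma polyfun_homog d n (g : 'rV[R]_d -> R) (pt : I -> 'rV[R]_d) : polyfun n g ->
  exists c : {ffun I -> 'I_n.+1} -> R, forall l : I -> R, \sum_i l i = 1 ->
    g (\sum_i l i *: pt i) = \sum_(s | @homog n s) c s * hmonom s l.
Proof.
move=> pg; suff [h [hh gh]] : exists h, hspan n h /\ forall l : I -> R,
    \sum_i l i = 1 -> g (\sum_i l i *: pt i) = h l.
  by have [c hE] := hspan_coef hh; exists c => l /gh ->; rewrite hE.
elim: pg => {n g} [n c|n i f pf [h [hh fh]]|n f g pf [h [hh fh]] pg [h' [hh' gh]]].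
- exists (fun l => c * (\sum_i l i) ^+ n); split; first exact: hspan_cst.
  by move=> l ->; rewrite expr1n mulr1.
- exists (fun l => \sum_v (pt v 0 i) * (l v * h l)); split.
    by apply: fspan_sum => v _; apply: fspanZ; exact: hspanM.
  move=> l l1; rewrite fh// summxE mulr_suml; apply: eq_bigr => v _.
  by rewrite mxE mulrA [X in X * _]mulrC.
- exists (fun l => h l + h' l); split; first exact: fspanD.
  by move=> l l1; rewrite fh// gh.
Qed.

(* Along [a + t (b - (\sum b) a)], which stays in the hyperplane of
   coordinate sum 1, the monomial of [s] is [t ^ s(S) (1 - t \sum b) ^ s(~: S)]
   up to a constant. *)
Lemma homog_vanish n (c : {ffun I -> 'I_n.+1} -> R) (S : {set I}) m (i0 : I) :
  i0 \notin S ->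
  (forall a b : I -> R, (forall i, i \in S -> a i = 0) -> \sum_i a i = 1 ->
    (forall i, i \notin S -> b i = 0) -> forall p : {poly R},
    (forall t, p.[t] = \sum_(s | @homog n s) c s *
       hmonom s (fun i => a i + t * (b i - (\sum_i b i) * a i))) ->
    forall j, (j <= m)%N -> p`_j = 0) ->
  forall s, homog s -> (\sum_(i in S) s i <= m)%N -> c s = 0.
Proof.
move=> i0S H s0 s0n s0m.
pose w (s : {ffun I -> 'I_n.+1}) := (\sum_(i in S) s i)%N.
have wn s : homog s -> (w s + \sum_(i | i \notin S) s i = n)%N.
  by move=> /eqP sn; rewrite -[RHS]sn [in RHS](bigID (mem S)).
(* By independence of monomials it suffices that each part of low weight in [S] vanishes at positive
   points. *)
suff Q0 j (y : I -> R) : (j <= m)%N -> (forall i, 0 < y i) ->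
    \sum_(s | @homog n s && (w s == j)) c s * hmonom s y = 0.
  apply: (monom_free (P := fun s => homog s && (w s == w s0)) (c := c)
    (e := fun (s : {ffun I -> 'I_n.+1}) i => s i)).
  - by move=> s s' _ _ ss'; apply/ffunP => i; apply: val_inj; exact: ss'.
  - by move=> y y0; exact: Q0.
  - by rewrite s0n eqxx.
move=> jm y0.
(* Rescaling by [A], positive thanks to [i0], makes the coordinates outside [S] sum to 1, as [a]
   requires; homogeneity carries the result back to [y]. *)
pose A := \sum_(i | i \notin S) y i.
have A0 : 0 < A.
  rewrite /A (bigD1 i0)//= ltr_pwDl//; apply: sumr_ge0 => i _; exact: ltW.
pose z i := y i / A.
suff Qz : \sum_(s | @homog n s && (w s == j)) c s * hmonom s z = 0.
  transitivity (A ^+ n * \sum_(s | @homog n s && (w s == j)) c s * hmonom s z).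
    rewrite mulr_sumr; apply: eq_bigr => s /andP[/eqP sn _]; rewrite -[X in _ ^+ X]sn.
    rewrite mulrCA /hmonom -monomZ; congr (_ * _); apply: eq_bigr => i _.
    by rewrite /z mulrCA divff ?mulr1// gt_eqF.
  by rewrite Qz mulr0.
pose a i := if i \in S then 0 else z i.
pose b i := if i \in S then z i else 0.
pose beta := \sum_i b i.
(* The terms of weight [k] in [S] together contribute [Q k] times [t ^ k (1 - beta t) ^ (n - k)]
   along the line. *)
pose Q k := \sum_(s | @homog n s && (w s == k)) c s * hmonom s z.
pose q (k : nat) : {poly R} := 'X^k * (1 - beta *: 'X) ^+ (n - k).
pose p := \sum_(k < n.+1) Q k *: q k.
have pE t : p.[t] = \sum_(s | @homog n s) c s *
       hmonom s (fun i => a i + t * (b i - (\sum_i b i) * a i)).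
  rewrite horner_sum (partition_big (fun s => inord (w s) : 'I_n.+1) xpredT)//=.
  apply: eq_bigr => k _; rewrite hornerZ mulr_suml.
  apply: eq_big => [s|s /andP[sn /eqP wk]].
    have [sn|//] := boolP (homog s).
    have ws : (w s < n.+1)%N by rewrite ltnS -[leqRHS](wn _ sn) leq_addr.
    apply/eqP/eqP => [wk|<-]; first by apply: val_inj; rewrite /= wk inordK// -wk.
    by rewrite inordK.
  rewrite -mulrA; congr (_ * _).
  rewrite /q !(hornerE, horner_exp) -{}wk.
  have -> : (n - w s = \sum_(i | i \notin S) s i)%N by rewrite -[X in (X - _)%N](wn s sn) addKn.
  rewrite mulrC /w -!prodrXr /hmonom /monom.
  rewrite [in RHS](bigID (mem S)) /= -mulrA [X in X * _](bigID (mem S)) /= mulrACA; congr (_ * _).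
    rewrite -big_split; apply: eq_bigr => i iS /=.
    by rewrite /a /b iS -exprMn; congr (_ ^+ _); ring.
  rewrite -big_split; apply: eq_bigr => i iS /=.
  by rewrite /a /b (negPf iS) -exprMn; congr (_ ^+ _); rewrite -/beta; ring.
have pm k : (k <= m)%N -> p`_k = 0.
  apply: (H a b _ _ _ p pE).
  - by move=> i iS; rewrite /a iS.
  - rewrite (bigID (mem S)) /= big1 ?add0r; last by move=> i iS; rewrite /a iS.
    under eq_bigr => i iS do rewrite /a (negPf iS).
    by rewrite -mulr_suml divff// gt_eqF.
  - by move=> i iS; rewrite /b (negPf iS).
(* The system is triangular: in the coefficient of degree [j], terms with [k < j] vanish by
   induction, terms with [k > j] start at a higher power, and [q j] contributes 1. *)
rewrite -/(Q j); elim/ltn_ind: j jm => j IH jm.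
have [nj|jn] := ltnP n j.
  apply: big1 => s /andP[sn /eqP ws]; move: nj.
  by rewrite -ws -[X in (X < _)%N](wn _ sn) ltnNge leq_addr.
have := pm _ jm; rewrite coef_sum (bigD1 (Ordinal (jn : (j < n.+1)%N)))//=.
rewrite big1 ?addr0 => [|k kj]; last first.
  rewrite coefZ; have [kltj|jk|kE] := ltngtP k j.
  - by rewrite IH ?mul0r// (leq_trans (ltnW kltj)).
  - by rewrite /q coefXnM jk mulr0.
  - by move: kj; rewrite -val_eqE /= kE eqxx.
rewrite coefZ /q coefXnM ltnn subnn -horner_coef0 horner_exp !hornerE.
by rewrite ?(mulr0, mul0r) subr0 expr1n mulr1.
Qed.

End homogeneous_representation.

(** * Affine combinations of vertices and barycentric coordinates *)

Section simplex_geometry.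
Context {R : realType} {d : nat}.
Implicit Types (F K : {fset 'rV[R]_d}).

Definition comb F (l : F -> R) : 'rV[R]_d := \sum_v l v *: val v.

Definition aff_hull F : set 'rV[R]_d := [set x | exists l : F -> R, \sum_v l v = 1 /\ x = comb l].

(** Affine independence through coefficients treats all vertices alike and passes directly to
    subsets, unlike the rank of [edge_mx]. *)
Definition aff_free F : Prop :=
  forall l : F -> R, \sum_v l v = 0 -> comb l = 0 -> forall v, l v = 0.

(** Extension by zero lets coefficients on different vertex sets be compared, and vertices be
    addressed by their position in the enumeration. *)
Definition extend0 F (l : F -> R) (x : 'rV[R]_d) : R := oapp l 0 (insub x).

Lemma extend0_val F (l : F -> R) v : extend0 l (val v) = l v.
Proof. by rewrite /extend0 valK. Qed.

Lemma extend0_out F (l : F -> R) x : x \notin F -> extend0 l x = 0.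
Proof. by move=> xF; rewrite /extend0; case: insubP => // u uF; rewrite uF in xF. Qed.

Lemma sum_extend0 F K (l : F -> R) : (F `<=` K)%fset ->
  \sum_(v : K) extend0 l (val v) = \sum_v l v.
Proof.
move=> FK; rewrite -(big_seq_fsetE _ _ predT (extend0 l)) /=.
rewrite -(big_fset_incl _ FK) => [|x _ xF]; last by rewrite extend0_out.
by rewrite big_seq_fsetE /=; apply: eq_bigr => v _; rewrite extend0_val.
Qed.

Lemma comb_extend0 F K (l : F -> R) : (F `<=` K)%fset ->
  comb (fun v : K => extend0 l (val v)) = comb l.
Proof.
move=> FK; rewrite /comb -(big_seq_fsetE _ _ predT (fun x => extend0 l x *: x)) /=.
rewrite -(big_fset_incl _ FK) => [|x _ xF]; last by rewrite extend0_out// scale0r.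
by rewrite big_seq_fsetE /=; apply: eq_bigr => v _; rewrite extend0_val.
Qed.

Lemma aff_freeS F K : (F `<=` K)%fset -> aff_free K -> aff_free F.
Proof.
move=> FK fK l l0 cl0 v.
have := fK (fun v => extend0 l (val v)).
rewrite sum_extend0// comb_extend0// => /(_ l0 cl0).
move=> /(_ [` (fsubsetP FK _ (valP v))]%fset) /=.
by rewrite extend0_val.
Qed.

Lemma combB F (l1 l2 : F -> R) : comb (fun v => l1 v - l2 v) = comb l1 - comb l2.
Proof. by rewrite /comb -sumrB; apply: eq_bigr => v _; rewrite scalerBl. Qed.

Lemma comb_inj F (l1 l2 : F -> R) : aff_free F -> \sum_v l1 v = \sum_v l2 v ->
  comb l1 = comb l2 -> l1 =1 l2.
Proof.
move=> fF s12 c12 v; apply/eqP; rewrite -subr_eq0; apply/eqP.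
apply: (fF (fun v => l1 v - l2 v)); first by rewrite sumrB s12 subrr.
by rewrite combB c12 subrr.
Qed.

(** Affine independence leaves [xget] a single candidate. *)
Lemma baryE F (l : F -> R) : aff_free F -> \sum_v l v = 1 -> bary F (comb l) =1 l.
Proof.
move=> fF l1; rewrite /bary.
have : [set c : {ffun F -> R} | \sum_v c v = 1 /\ \sum_v c v *: val v = comb l]
    [ffun v => l v].
  by rewrite /=; split; [rewrite -[RHS]l1|rewrite /comb]; apply: eq_bigr => v _; rewrite ffunE.
case: xgetP => [c _ [c1 cc] _ v|/(_ [ffun v => l v])//].
by apply: comb_inj => //; rewrite c1 l1.
Qed.

Lemma sum_vertices F (V : lmodType R) (f : 'rV[R]_d -> V) : F != fset0 ->
  \sum_(v : F) f (val v) = f F`_0 + \sum_(i < #|` F|.-1) f F`_i.+1.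
Proof.
move=> F0; have cF : (0 < size F)%N by rewrite lt0n size_eq0.
rewrite -(big_seq_fsetE _ _ predT f) /= (big_nth 0) big_mkord /=.
by case: (enum_fset F) cF => [//|x s _] /=; rewrite big_ord_recl.
Qed.

Lemma sum_extend0_vertices F (l : F -> R) : F != fset0 ->
  \sum_v l v = extend0 l F`_0 + \sum_(i < #|` F|.-1) extend0 l F`_i.+1.
Proof.
move=> F0; rewrite -(sum_vertices (V := R^o) _ F0).
by apply: eq_bigr => v _; rewrite extend0_val.
Qed.

(** Eliminating the coefficient of the first vertex links combinations of vertices to the
    parametrization in [simplex_int]. *)
Lemma comb_edge F (l : F -> R) : F != fset0 ->
  comb l = (\sum_v l v) *: F`_0 + (\row_i extend0 l F`_i.+1) *m edge_mx F.
Proof.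
move=> F0.
have -> : comb l = \sum_(v : F) extend0 l (val v) *: val v.
  by apply: eq_bigr => v _; rewrite extend0_val.
rewrite sum_extend0_vertices// (sum_vertices (fun x => extend0 l x *: x) F0).
rewrite scalerDl -addrA; congr (_ + _).
rewrite mulmx_sum_row scaler_suml -big_split; apply: eq_bigr => i _ /=.
by rewrite mxE rowK scalerBr addrC subrK.
Qed.

(** A right inverse of the edge matrix kills every coefficient but the first, and the zero sum kills
    that one. *)
Lemma aff_free_row_free F : affine_indep F -> aff_free F.
Proof.
move=> /row_freeP[B EB] l l0; have [F0|F0] := eqVneq F fset0.
  by move=> _ v; have := fsvalP v; move/eqP: F0; rewrite -cardfs_eq0 cardfE => /eqP/card0_eq/(_ v).
rewrite comb_edge// l0 scale0r add0r => /(congr1 (mulmx^~ B)).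
rewrite -mulmxA EB mulmx1 mul0mx => /rowP H.
have Hi i : (i < #|` F|.-1)%N -> extend0 l F`_i.+1 = 0.
  by move=> ilt; have := H (Ordinal ilt); rewrite !mxE.
have cF : (0 < #|` F|)%N by rewrite cardfs_gt0.
have l0' : extend0 l F`_0 = 0.
  move: l0; rewrite sum_extend0_vertices// big1 ?addr0// => i _.
  by rewrite Hi.
move=> v; rewrite -extend0_val.
have /(nthP 0)[i ilt <-] : val v \in enum_fset F by exact: (valP v).
by case: i ilt => [//|i] ilt; apply: Hi; rewrite -ltnS (prednK cF).
Qed.

End simplex_geometry.

(** * Subsimplices as sets of vertices *)

Section vertex_sets.
Context {T : choiceType}.
Implicit Types F K : {fset T}.

Definition vset F (S : {set F}) : {fset T} := [fset val v | v in S]%fset.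

Lemma in_vset F (S : {set F}) v : (val v \in vset S) = (v \in S).
Proof. by rewrite /vset mem_imfset //=; exact: val_inj. Qed.

Lemma vset_sub F (S : {set F}) : (vset S `<=` F)%fset.
Proof. by apply/fsubsetP => x /imfsetP[v _ ->]; exact: valP. Qed.

Lemma fsub_vset F (S : {set F}) : fsub F (vset S) = S.
Proof. by apply/setP => v; rewrite in_fsub in_vset. Qed.

Lemma vset_fsub F K : (F `<=` K)%fset -> vset (fsub K F) = F.
Proof.
move=> FK; apply/fsetP => x; apply/imfsetP/idP => [[v /=] + ->|xF]; first by rewrite in_fsub.
by exists [` fsubsetP FK _ xF]%fset => //=; rewrite in_fsub.
Qed.

Lemma card_vset F (S : {set F}) : #|` vset S| = #|S|.
Proof. by rewrite -(card_fsub (vset_sub S)) fsub_vset. Qed.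

End vertex_sets.

(** * Edge coordinates, normal frames and the Gram determinant *)

Section edges.
Context {R : realType} {d : nat}.
Implicit Types (F K : {fset 'rV[R]_d}).

(** Converse of [comb_edge]: the first vertex receives [a - \sum_i t 0 i], the others the entries of
    [t]. Total 0 gives tangent directions, total 1 gives points; the last clause serves sign
    conditions. *)
Lemma edge_coord F (a : R) (t : 'rV[R]_(#|` F|.-1)) : F != fset0 ->
  exists l : F -> R, [/\ \sum_v l v = a, comb l = a *: F`_0 + t *m edge_mx F &
    forall i : 'I_(#|` F|.-1), extend0 l F`_i.+1 = t 0 i] /\
    forall v, l v = a - \sum_i t 0 i \/ exists i, l v = t 0 i.
Proof.
move=> F0; have cF : (0 < #|` F|)%N by rewrite cardfs_gt0.
pose f (j : nat) := oapp (fun i => t 0 i) 0 (insub j : option 'I_(#|` F|.-1)).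
pose l (v : F) := if index (val v) F is j.+1 then f j else a - \sum_i t 0 i.
have le (i : nat) : (i < #|` F|)%N ->
    extend0 l F`_i = if i is j.+1 then f j else a - \sum_i t 0 i.
  move=> ilt; have iF : F`_i \in F by exact: mem_nth.
  rewrite -[F`_i]/(val [` iF]%fset) extend0_val /l /=.
  by rewrite index_uniq// fset_uniq.
have sl : \sum_v l v = a.
  transitivity (\sum_(v : F) extend0 l (val v)).
    by apply: eq_bigr => v _; rewrite extend0_val.
  rewrite -(big_seq_fsetE _ _ predT (extend0 l)) /= (big_nth 0) big_mkord /= -/(#|` F|).
  rewrite (eq_bigr (fun i : 'I_#|` F| =>
    if (i : nat) is j.+1 then f j else a - \sum_i t 0 i)) => [|i _]; last exact: le.
  have sE n m (b : R) : m.+1 = n -> \sum_(i < n) (if (i : nat) is j.+1 then f j else b) =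
      b + \sum_(i < m) f i.
    by move=> <-; rewrite big_ord_recl; congr (_ + _).
  rewrite (sE _ _ _ (prednK cF)) [X in _ + X](eq_bigr (fun i => t 0 i)) ?subrK// => i _.
  by rewrite /f valK.
have lt (i : 'I_(#|` F|.-1)) : extend0 l F`_i.+1 = t 0 i.
  by rewrite le ?/f ?valK// -[X in (_ < X)%N](prednK cF) ltnS.
exists l; split; first split => //.
  by rewrite comb_edge// sl; congr (_ + _ *m _); apply/rowP => i; rewrite mxE lt.
move=> v; rewrite /l; case E : (index _ _) => [|j]; first by left.
have jlt : (j < #|` F|.-1)%N.
  by rewrite -ltnS (prednK cF) -E index_mem; exact: valP.
by right; exists (Ordinal jlt); rewrite /f insubT.
Qed.

Lemma row_free_aff_free F : F != fset0 -> aff_free F -> affine_indep F.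
Proof.
move=> F0 fF; apply: inj_row_free => t tE.
have [l [[l0 lc lt] _]] := edge_coord 0 t F0.
have {}l0 : forall v, l v = 0 by apply: fF => //; rewrite lc scale0r add0r.
apply/rowP => i; rewrite mxE -lt /extend0.
by case: insubP => //= u _ _; rewrite l0.
Qed.

Lemma aff_hull_edge F x (t : 'rV[R]_(#|` F|.-1)) : F != fset0 -> aff_hull F x ->
  aff_hull F (x + t *m edge_mx F).
Proof.
move=> F0 [l [l1 ->]]; have [l' [[l0 lc _] _]] := edge_coord 0 t F0.
exists (fun v => l v + l' v); split; first by rewrite big_split /= l1 l0 addr0.
rewrite scale0r add0r in lc; rewrite -lc /comb -big_split /=.
by apply: eq_bigr => v _; rewrite scalerDl.
Qed.

Lemma card_row_free F : affine_indep F -> (#|` F|.-1 <= d)%N.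
Proof. by move=> /eqP <-; exact: rank_leq_col. Qed.

Definition normal_frame F (N : 'M[R]_(codim F, d)) :=
  [/\ F != fset0, aff_free F, N *m N^T = 1%:M & edge_mx F *m N^T = 0].

(** Edges and normals are jointly independent, since multiplication by [N^T] isolates the normal
    part, and there are exactly [d] of them. *)
Lemma normal_frame_decomp F (N : 'M[R]_(codim F, d)) (w : 'rV[R]_d) : normal_frame N ->
  exists (a : 'rV_(#|` F|.-1)) (b : 'rV_(codim F)), w = a *m edge_mx F + b *m N.
Proof.
move=> [F0 fF NN EN].
have rE := row_free_aff_free F0 fF.
have rf : row_free (col_mx (edge_mx F) N).
  apply: inj_row_free => v; rewrite -[v]hsubmxK mul_row_col => /[dup] H.
  move=> /(congr1 (mulmx^~ N^T)).
  rewrite mulmxDl -!mulmxA NN EN mulmx0 add0r mulmx1 mul0mx => v0.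
  move: H; rewrite v0 mul0mx addr0 => /(congr1 (mulmx^~ (pinvmx (edge_mx F)))).
  by rewrite mulmxKp ?mul0mx// => ->; rewrite row_mx0.
have rf' : row_full (col_mx (edge_mx F) N).
  move: rf; rewrite /row_free /row_full => /eqP ->; apply/eqP.
  have := card_row_free rE; have : (0 < #|` F|)%N by rewrite cardfs_gt0.
  by rewrite /codim; lia.
have /submxP[D ->] : (w <= col_mx (edge_mx F) N)%MS by exact: submx_full.
exists (lsubmx D), (rsubmx D).
by rewrite -mul_row_col hsubmxK.
Qed.

(** Stacking [E] on [N] gives a square matrix whose product with its transpose is block diagonal
    with blocks [E *m E^T] and 1, so the Gram determinant is a square. It is nonzero because
    [v *m E *m E^T = 0] forces the squared length of [v *m E] to vanish. *)
Lemma gram_det_gt0 F (N : 'M[R]_(codim F, d)) : normal_frame N ->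
  0 < \det (edge_mx F *m (edge_mx F)^T).
Proof.
move=> [F0 fF NN EN]; have rE : row_free (edge_mx F) := row_free_aff_free F0 fF.
have e : (#|` F|.-1 + codim F = d)%N.
  have := card_row_free rE; have : (0 < #|` F|)%N by rewrite cardfs_gt0.
  by rewrite /codim; lia.
(* The sizes are generalized so that [d] can be replaced by [m + s], which makes [col_mx E N]
   square. *)
move: NN EN rE; move: (edge_mx F) (N) => {F0 fF}; move: (#|` F|.-1) (codim F) e => m s.
case: _ / => {F N} E N NN EN rE.
have MM : \det (E *m E^T) = \det (col_mx E N) ^+ 2.
  rewrite expr2 -[in X in _ = _ * X]det_tr -det_mulmx tr_col_mx mul_col_row NN EN.
  by rewrite -[N *m E^T]trmxK trmx_mul trmxK EN trmx0 det_ublock det1 mulr1.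
rewrite lt_def MM sqr_ge0 andbT -MM -unitfE -unitmxE -row_free_unit.
apply: inj_row_free => v vE.
have vE0 : v *m E = 0.
  have : (v *m E) *m (v *m E)^T = 0 by rewrite trmx_mul mulmxA -(mulmxA v) vE mul0mx.
  move=> /matrixP/(_ 0 0); rewrite !mxE => /eqP; rewrite psumr_eq0; last first.
    by move=> i _; rewrite [_^T _ _]mxE -expr2 sqr_ge0.
  move=> /allP H; apply/rowP => i; have := H i (mem_index_enum _).
  by rewrite [_^T _ _]mxE mulf_eq0 orbb => /eqP ->; rewrite mxE.
by have := congr1 (mulmx^~ (pinvmx E)) vE0; rewrite mulmxKp ?mul0mx.
Qed.

End edges.

(** * Vanishing of all derivatives along a subsimplex *)

Section flatness.
Context {R : realType} {d : nat}.
Implicit Types (F K : {fset 'rV[R]_d}) (u g : 'rV[R]_d -> R).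

Definition flat m u x := forall ws, (size ws <= m)%N -> iter_derive ws u x = 0.

(** A tangent line stays in the affine hull, so [g] restricts to the zero polynomial on it. *)
Lemma ddir_aff_hull k F g (t : 'rV[R]_(#|` F|.-1)) x : F != fset0 -> polyfun k g ->
  (forall y, aff_hull F y -> g y = 0) -> aff_hull F x -> ddir (t *m edge_mx F) g x = 0.
Proof.
move=> F0 pg g0 Fx; have [p Hp] := polyfun_line x (t *m edge_mx F) pg.
have p0 : p = 0.
  apply: poly_eq_fun => s; have [<- _] := Hp s.
  by rewrite horner0 g0// scalemxAl; exact: aff_hull_edge.
by have [_] := Hp 0; rewrite scale0r addr0 p0 derivC horner0 => ->.
Qed.

(** Each direction splits into a tangent part, which differentiates a function vanishing on the
    hull, and normal ones. The induction moves the directions of [ws] one by one into the list [l]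
    of normals. *)
Lemma flat_normal k F (N : 'M[R]_(codim F, d)) M u : normal_frame N -> polyfun k u ->
  (forall theta : 'I_(codim F) -> nat, (\sum_i theta i <= M)%N ->
    forall x, aff_hull F x -> normal_derive N theta u x = 0) ->
  forall x, aff_hull F x -> flat M u x.
Proof.
move=> NF pu H; suff main ws (l : seq 'I_(codim F)) : (size ws + size l <= M)%N ->
    forall x, aff_hull F x -> iter_derive (ws ++ [seq row i N | i <- l]) u x = 0.
  move=> x Fx ws wsM; have := main ws [::]; rewrite /= cats0; apply => //.
  by rewrite addn0.
elim: ws l => [|w ws IH] l szM x Fx.
  by rewrite cat0s (iter_derive_normal _ _ pu) H// sum_count_mem.
have [F0 _ _ _] := NF.
rewrite /=; have [a [b ->]] := normal_frame_decomp w NF.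
have pg := polyfun_iter_deriveT (ws ++ [seq row i N | i <- l]) pu.
rewrite (derive_dirD _ _ _ pg) (ddir_aff_hull _ F0 pg _ Fx) ?add0r; last first.
  by apply: IH; exact: leq_trans (leqnSn _) szM.
rewrite mulmx_sum_row (derive_dir_sum _ _ _ pg) big1// => i _.
rewrite -[ddir _ _]/(iter_derive (_ :: _) _).
rewrite (iter_derive_perm pu (ws' := ws ++ [seq row i N | i <- i :: l])); last first.
  by rewrite /= -cat1s perm_catCA.
by rewrite IH ?mulr0//= addnS.
Qed.

End flatness.

(** * Integration of polynomials on the standard simplex *)

Section integration_on_the_standard_simplex.
Context {R : realType}.

Lemma polyfun_continuous m n (f : 'rV[R]_m -> R) : polyfun n f -> continuous f.
Proof.
elim => {n f} [n c|n i f _ IH|n f g _ IHf _ IHg] x.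
- exact: cst_continuous.
- by apply: (cvgM (@coord_continuous _ _ _ 0 i x) (IH x)).
- exact: (cvgD (IHf x) (IHg x)).
Qed.

Lemma polyfun_measurable m n (f : 'rV[R]_m -> R) : polyfun n f -> measurable_fun setT f.
Proof.
elim => {n f} [n c|n i f _ IH|n f g _ IHf _ IHg].
- exact: measurable_cst.
- by apply: measurable_realfun.measurable_funM => //; exact: measurable_coord.
- exact: measurable_realfun.measurable_funD.
Qed.

Lemma std_simplex_le1 m (t : 'rV[R]_m) i : std_simplex t -> t 0 i <= 1.
Proof.
by move=> [t0 t1]; apply: le_trans t1; rewrite (bigD1 i)//= lerDl sumr_ge0.
Qed.

Lemma polyfun_bounded m n (f : 'rV[R]_m -> R) : polyfun n f ->
  exists C, forall t, std_simplex t -> `|f t| <= C.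
Proof.
elim => {n f} [n c|n i f _ [C HC]|n f g _ [C HC] _ [D HD]].
- by exists `|c|.
- exists C => t st; rewrite normrM; apply: le_trans (HC t st).
  have [t0 _] := st.
  by rewrite ger0_norm// ler_piMl// std_simplex_le1.
- by exists (C + D) => t st; rewrite (le_trans (ler_normD _ _))// lerD ?HC ?HD.
Qed.

Lemma measurable_std_simplex m : measurable (@std_simplex R m).
Proof.
have -> : @std_simplex R m = (\bigcap_(i : 'I_m) [set t | 0 <= t 0 i]) `&`
    [set t | \sum_i t 0 i <= 1].
  apply/seteqP; split => t [t0 t1]; split => //= i; first by move=> _; exact: t0.
  exact: (t0 i I).
have mc (i : 'I_m) : measurable_fun setT (fun t : 'rV[R]_m => t 0 i : R).
  exact: measurable_coord.
apply: measurableI.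
  apply: fin_bigcap_measurable => // i _.
  have := mc i measurableT _ (measurable_itv `[0, +oo[); rewrite setTI.
  by congr (measurable _); apply/seteqP; split => t /=; rewrite in_itv /= andbT.
have := @measurable_sum _ _ _ setT 'I_m (index_enum _) (fun i (t : 'rV[R]_m) => t 0 i) mc.
move=> /(_ measurableT _ (measurable_itv `]-oo, 1])); rewrite setTI.
by congr (measurable _); apply/seteqP; split => t /=; rewrite in_itv.
Qed.

Definition box m (a b : 'rV[R]_m) : set 'rV[R]_m :=
  [set t | forall i, a 0 i <= t 0 i <= b 0 i].

Lemma measurable_box m (a b : 'rV[R]_m) : measurable (box a b).
Proof.
have -> : box a b = \bigcap_(i : 'I_m) (fun t : 'rV[R]_m => t 0 i) @^-1` `[a 0 i, b 0 i].
  apply/seteqP; split => t H i; first by move=> _; rewrite /= in_itv; exact: H.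
  by have := H i I; rewrite /= in_itv.
apply: fin_bigcap_measurable => // i _.
by rewrite -[X in measurable X]setTI; exact: measurable_coord.
Qed.

(** Boxes serve twice: the unit box bounds the measure of the simplex, and small boxes show that a
    neighbourhood is not null. *)
Lemma lebesgue_rV_box m (a b : 'rV[R]_m) : (forall i, a 0 i < b 0 i) ->
  lebesgue_rV m (box a b) = (\prod_i (b 0 i - a 0 i))%:E.
Proof.
elim: m a b => [|m IH] a b ab.
  rewrite big_ord0 /= diracE (_ : _ \in _)//.
  by rewrite inE => -[].
pose tl (x : 'rV[R]_m.+1) : 'rV[R]_m := \row_i x 0 (lift ord0 i).
rewrite /= /lebesgue_rV_step /pushforward.
have -> : @cons_rV R m @^-1` box a b = `[a 0 0, b 0 0] `*` box (tl a) (tl b).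
  apply/seteqP; split => [[x t]/= H|[x t]/= [H1 H2] i].
    split; first by have := H ord0; rewrite cons_rV0 in_itv.
    by move=> i; have := H (lift ord0 i); rewrite cons_rVS !mxE.
  have [j ->|->] := unliftP ord0 i; last by rewrite cons_rV0; move: H1; rewrite in_itv.
  by rewrite cons_rVS; have := H2 j; rewrite !mxE.
rewrite product_measure1E//; last exact: measurable_box.
rewrite IH; last by move=> i; rewrite !mxE.
rewrite big_ord_recl EFinM; congr (_ * _)%E.
  have := @lebesgue_measure_itv R `[a 0 0, b 0 0].
  by rewrite /= lte_fin ab -EFinD.
by congr (_ %:E); apply: eq_bigr => i _; rewrite !mxE.
Qed.

Lemma std_simplex_finite m : (lebesgue_rV m (@std_simplex R m) < +oo)%E.
Proof.
apply: (@le_lt_trans _ _ (lebesgue_rV m (box (const_mx 0 : 'rV[R]_m) (const_mx 1)))).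
  apply: le_measure; rewrite ?inE; [exact: measurable_std_simplex|exact: measurable_box|].
  by move=> t st i; rewrite !mxE std_simplex_le1// andbT; have [] := st.
by rewrite lebesgue_rV_box ?ltry// => i; rewrite !mxE.
Qed.

Lemma integrable_polyfunM m n (f g : 'rV[R]_m -> R) : polyfun n f -> polyfun n g ->
  (lebesgue_rV m).-integrable (@std_simplex R m) (EFin \o (fun t => f t * g t)).
Proof.
move=> pf pg; have [C HC] := polyfun_bounded pf; have [D HD] := polyfun_bounded pg.
apply: measurable_bounded_integrable.
- exact: measurable_std_simplex.
- exact: std_simplex_finite.
- apply: measurable_funTS; apply: measurable_realfun.measurable_funM.
    exact: polyfun_measurable pf.
  exact: polyfun_measurable pg.
- exists (C * D); split; first exact: num_real.
  move=> M CDM t st; apply: le_trans (ltW CDM).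
  by rewrite normrM ler_pM ?HC ?HD.
Qed.

(** If [g t] were nonzero at an interior point, [g] would be nonzero on a box around it; yet the
    integral of the square forces this box into a null set. *)
Lemma polyfun_int_sqr_eq0 m n (g : 'rV[R]_m -> R) : polyfun n g ->
  \int[lebesgue_rV m]_(t in @std_simplex R m) (g t * g t) = 0 ->
  forall t : 'rV[R]_m, (forall i, 0 < t 0 i) -> \sum_i t 0 i < 1 -> g t = 0.
Proof.
move=> pg int0 t t0 t1; apply/eqP/negPn/negP => gt0.
have mS := @measurable_std_simplex m.
have intf := integrable_polyfunM pg pg.
have {int0} : (\int[lebesgue_rV m]_(t in @std_simplex R m) `|(g t * g t)%:E| = 0)%E.
  have -> : (\int[lebesgue_rV m]_(t in @std_simplex R m) `|(g t * g t)%:E| =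
      \int[lebesgue_rV m]_(t in @std_simplex R m) (g t * g t)%:E)%E.
    by apply: eq_integral => s _; rewrite gee0_abs// lee_fin -expr2 sqr_ge0.
  rewrite -[LHS]fineK; first by move: int0; rewrite /Rintegral => ->.
  exact: integrable_fin_num.
have mf := measurable_int _ intf.
move=> /(ae_eq_integral_abs _ mS mf)[N [mN N0 sN]].
have : nbhs t [set s : 'rV[R]_m | [/\ forall i, 0 < s 0 i, \sum_i s 0 i < 1 & g s != 0]].
  near=> s; split; near: s.
  - apply: filter_forall => i.
    exact: (cvgr_gt _ (@coord_continuous _ _ _ 0 i t)).
  - have cs : (fun s : 'rV[R]_m => \sum_i s 0 i) s @[s --> t] --> \sum_i t 0 i.
      apply: (polyfun_continuous (n := 1)); apply: polyfun_sum => i _.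
      by apply: polyfun_ext (polyfun_coordM i (polyfun_cst _ 0 1)) => s; rewrite mulr1.
    exact: (cvgr_lt _ cs).
  - by apply: (cvgr_neq0 (g t)) => //; exact: (polyfun_continuous pg).
move=> /nbhs_ballP[e /= e0 He].
(* Balls are entrywise, so a box of half-width [e / 2] fits inside the ball of radius [e]. *)
pose a := \row_i (t 0 i - e / 2); pose b := \row_i (t 0 i + e / 2).
have ab i : a 0 i < b 0 i by rewrite !mxE; lra.
have boxN : box a b `<=` N.
  move=> s sab; apply: sN => /=.
  have [s0 s1 gs] : [/\ forall i, 0 < s 0 i, \sum_i s 0 i < 1 & g s != 0].
    apply: He; split => // i j; rewrite [i]ord1 /ball /=.
    have := sab j; rewrite !mxE => sj; rewrite ltr_norml; lra.
  move=> /(_ (conj (fun i => ltW (s0 i)) (ltW s1))) [] /eqP.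
  by rewrite mulf_eq0 orbb (negPf gs).
have : (lebesgue_rV m (box a b) <= lebesgue_rV m N)%E.
  by apply: le_measure; rewrite ?inE//; exact: measurable_box.
rewrite N0 lebesgue_rV_box// lee_fin leNgt prodr_gt0// => i _.
by rewrite subr_gt0.
Unshelve. all: by end_near. Qed.

End integration_on_the_standard_simplex.

(** * From degrees of freedom to derivatives on subsimplices *)

Section degrees_of_freedom_determine_derivatives.
Context {R : realType} {d : nat}.
Variables r k : nat.
Implicit Types (F K E : {fset 'rV[R]_d}) (u g : 'rV[R]_d -> R).

(** Keeps the orders of differentiation at most [k], so that [k - n] is a true difference. *)
Lemma max_order_le F : F != fset0 -> (max_order r (codim F) <= 2 ^ d * r)%N.
Proof.
rewrite -cardfs_gt0 => F0; have : (codim F <= d)%N by rewrite /codim; lia.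
case: (codim F) => [//|s sd] /=.
by rewrite leq_mul2r leq_pexp2l ?orbT// ltnW.
Qed.

(** If an exponent violates admissibility at [S], flatness of [u] on the face opposite [S] kills the
    low-order coefficients along lines leaving that face, and [homog_vanish] makes its coefficient
    zero. *)
Lemma normal_derive_coef F (N : 'M[R]_(codim F, d)) (theta : 'I_(codim F) -> nat) u :
  (2 ^ d * r <= k)%N -> normal_frame N -> polyfun k u ->
  (\sum_i theta i <= max_order r (codim F))%N ->
  (forall E, (E `<` F)%fset -> E != fset0 ->
    forall x, aff_hull E x -> flat (max_order r (codim E)) u x) ->
  let n := (\sum_i theta i)%N in
  exists c : {ffun F -> 'I_(k - n).+1} -> R,
    (forall l : F -> R, \sum_v l v = 1 ->
      normal_derive N theta u (comb l) = \sum_(s | homog s) c s * hmonom s l) /\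
    forall s, homog s -> c s != 0 -> admissible r k n (fun v => s v).
Proof.
move=> kr NF pu thF flatE n.
have [F0 fF _ _] := NF.
set ws := flatten [seq nseq (theta i) (row i N) | i <- enum 'I_(codim F)].
have gE : normal_derive N theta u = iter_derive ws u by exact: normal_derive_iter.
have szws : size ws = n by exact: size_flatten_theta.
have nk : (n <= k)%N by rewrite (leq_trans thF)// (leq_trans (max_order_le F0)).
have pg : polyfun (k - n) (iter_derive ws u).
  by rewrite -[in (k - n)%N]szws; exact: polyfun_iter_derive.
rewrite gE; have [c cP] := polyfun_homog (fun v : F => val v) pg; exists c; split => // s hs cs0.
split; first by rewrite [X in (X + _)%N](eqP hs) subnK.
move=> S /andP[S0 SF]; rewrite ltnNge; apply/negP => le_s.
have [i0 i0S] : exists i0, i0 \notin S.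
  apply/existsP; rewrite -negb_forall; apply: contraL SF => /forallP ST.
  rewrite -leqNgt cardfE -cardsT subset_leq_card//; apply/fintype.subsetP => v _; exact: ST.
(* The face of [F] opposite to [S], where the coordinates in [S] vanish. *)
pose E := vset (~: S).
have cardE : (#|` E| = #|` F| - #|S|)%N.
  by rewrite card_vset cardsCs finset.setCK cardfE.
have E0 : E != fset0 by rewrite -cardfs_gt0 cardE subn_gt0.
have EF : (E `<` F)%fset.
  by rewrite fproperEcard vset_sub cardE; lia.
have cF : (#|` F| <= d.+1)%N.
  have cF0 : (0 < #|` F|)%N by rewrite cardfs_gt0.
  by rewrite -(prednK cF0) ltnS; exact: card_row_free (row_free_aff_free F0 fF).
(* Exhibiting a successor turns [max_order r (codim E)] into the power appearing in [admissible]. *)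
have cE : codim E = (#|S| + codim F - 1).+1 by rewrite /codim cardE; lia.
move/negP: cs0; apply; apply/eqP.
(* The [n] derivatives already in [ws] are subtracted from the order of flatness on [E]. *)
apply: (homog_vanish (S := S) (m := (2 ^ (#|S| + codim F - 1) * r - n)%N) i0S _ hs); last first.
  by rewrite -(leq_add2r n) subnK// (leq_trans _ le_s) ?leq_addl.
move=> a b aS a1 bS p pE j jm.
have Ex0 : aff_hull E (comb a).
  exists (fun v : E => extend0 a (val v)); split.
    rewrite -a1 -(big_seq_fsetE _ _ predT (extend0 a)) /=.
    rewrite (big_fset_incl _ (vset_sub _)) => [|x]; last first.
      move=> /=xF; rewrite -[x]/(val [` xF]%fset) in_vset inE negbK => /aS.
      by rewrite extend0_val.
    by rewrite big_seq_fsetE; apply: eq_bigr => v _; rewrite extend0_val.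
  rewrite /comb -(big_seq_fsetE _ _ predT (fun x => extend0 a x *: x)) /=.
  rewrite (big_fset_incl _ (vset_sub _)) => [|x]; last first.
    move=> /=xF; rewrite -[x]/(val [` xF]%fset) in_vset inE negbK => /aS.
    by rewrite extend0_val => ->; rewrite scale0r.
  by rewrite big_seq_fsetE; apply: eq_bigr => v _; rewrite extend0_val.
set w := comb (fun v => b v - (\sum_i b i) * a v).
have [q qP] := iter_derive_line (comb a) w pg.
have pq : p = q.
  apply: poly_eq_fun => t; have := qP 0%N t; rewrite derivn0 /= => <-.
  rewrite pE -cP.
    congr (iter_derive ws u _); rewrite /w /comb scaler_sumr -big_split /=.
    by apply: eq_bigr => v _; rewrite scalerDl scalerA.
  rewrite big_split /= a1 -mulr_sumr sumrB -mulr_sumr a1 mulr1 subrr.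
  by rewrite mulr0 addr0.
have := qP j 0; rewrite scale0r addr0 -iter_derive_cat.
rewrite (flatE _ EF E0 _ Ex0); last first.
  by rewrite size_cat size_nseq szws cE /= addnC -leq_subRL// (leq_trans _ le_s)// leq_addl.
(* At 0 the [j]-th derivative is [j!] times the coefficient of degree [j]. *)
rewrite -pq horner_coef0 coef_derivn addn0 ffactnn => /esym/eqP.
by rewrite -mulr_natr mulf_eq0 pnatr_eq0 (gtn_eqF (fact_gt0 j)) orbF => /eqP.
Qed.

(** Makes [g] itself, cut off outside [F], an allowed test function. *)
Lemma bubble_coef F n g (c : {ffun F -> 'I_(k - n).+1} -> R) : aff_free F ->
  (forall l : F -> R, \sum_v l v = 1 -> g (comb l) = \sum_(s | homog s) c s * hmonom s l) ->
  (forall s, homog s -> c s != 0 -> admissible r k n (fun v => s v)) ->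
  bubble r k F n (g \_ (conv_hull F)).
Proof.
move=> fF gE cadm; rewrite /bubble; set A := (X in fspan X).
have -> : g \_ (conv_hull F) = (fun x => \sum_(s | @homog _ (k - n) s)
    (c s * ((fun x => hmonom s (bary F x)) \_ (conv_hull F)) x)).
  apply/funext => x; rewrite patchE; case: ifPn => [|xF].
    rewrite inE => Fx; have [l [_ l1 xE]] := Fx.
    rewrite xE gE//; apply: eq_bigr => s _; rewrite patchT; last by rewrite inE -xE.
    by congr (_ * _); apply: eq_bigr => v _; rewrite baryE.
  by rewrite big1// => s _; rewrite patchE (negPf xF) mulr0.
apply: fspan_sum => s hs; have [->|cs] := eqVneq (c s) 0.
  by under eq_fun do rewrite mul0r; exact: fspan0.
apply: fspanZ; apply: fspan_incl; exists (fun v => s v : nat); split => //.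
exact: cadm.
Qed.

Lemma std_simplex_conv_hull F (t : 'rV[R]_(#|` F|.-1)) : F != fset0 -> std_simplex t ->
  conv_hull F (F`_0 + t *m edge_mx F).
Proof.
move=> F0 [t0 t1]; have [l [[l1 lc _] lt]] := edge_coord 1 t F0.
exists l; split => //; last by rewrite -/(comb l) lc scale1r.
by move=> v; have [->|[i ->]] := lt v; rewrite ?subr_ge0.
Qed.

(** The Gram factor is positive, and a zero integral of [1 * 1] would make the constant 1 vanish at
    the interior point with all coordinates [m.+1%:R^-1]. *)
Lemma simplex_vol_neq0 F (N : 'M[R]_(codim F, d)) : normal_frame N -> simplex_vol F != 0.
Proof.
move=> NF; rewrite /simplex_vol /simplex_int mulf_neq0 ?sqrtr_eq0 -?ltNge ?(gram_det_gt0 NF)//.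
apply/eqP => int0; set m := (#|` F|.-1) in int0.
have m0 : 0 < m.+1%:R^-1 :> R by rewrite invr_gt0.
suff /eqP : 1 = 0 :> R by rewrite oner_eq0.
apply: (@polyfun_int_sqr_eq0 R m 0 (fun=> 1) (polyfun_cst _ _ _) _ (const_mx m.+1%:R^-1)).
- by under eq_Rintegral do rewrite mulr1.
- by move=> i; rewrite mxE.
- under eq_bigr do rewrite mxE.
  by rewrite sumr_const card_ord -[ltLHS]mulr_natl ltr_pdivrMr// mul1r ltr_nat.
Qed.

(** After cancelling the volume and the Gram factor, the difference of the two sides is the integral
    of the square of [g1 - g2]. *)
Lemma simplex_int_bubble F (N : 'M[R]_(codim F, d)) m g1 g2 : normal_frame N ->
  polyfun m g1 -> polyfun m g2 ->
  let v := (fun x => g1 x - g2 x) \_ (conv_hull F) in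
  (simplex_vol F)^-1 * simplex_int F (fun x => g1 x * v x) =
    (simplex_vol F)^-1 * simplex_int F (fun x => g2 x * v x) ->
  forall l : F -> R, (forall x, 0 < l x) -> \sum_x l x = 1 -> g1 (comb l) - g2 (comb l) = 0.
Proof.
move=> NF pg1 pg2 v; have [F0 _ _ _] := NF.
have vol0 : (simplex_vol F)^-1 != 0 by rewrite invr_eq0 (simplex_vol_neq0 NF).
move/(mulfI vol0).
have gram0 : Num.sqrt (\det (edge_mx F *m (edge_mx F)^T)) != 0.
  by rewrite sqrtr_eq0 -ltNge (gram_det_gt0 NF).
move/(mulfI gram0).
pose par (t : 'rV[R]_(#|` F|.-1)) := F`_0 + t *m edge_mx F.
have pG1 : polyfun m (g1 \o par) by exact: polyfun_affine.
have pG2 : polyfun m (g2 \o par) by exact: polyfun_affine.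
have pG := polyfunB pG1 pG2.
have vE t : t \in @std_simplex R (#|` F|.-1) -> v (par t) = g1 (par t) - g2 (par t).
  by rewrite inE => st; rewrite /v patchT// inE; exact: std_simplex_conv_hull.
rewrite (@eq_Rintegral _ _ _ (lebesgue_rV _) _
  (fun t => (g1 \o par) t * (g1 (par t) - g2 (par t)))); last first.
  by move=> t st; rewrite vE.
rewrite [RHS](@eq_Rintegral _ _ _ (lebesgue_rV _) _
  (fun t => (g2 \o par) t * (g1 (par t) - g2 (par t)))); last first.
  by move=> t st; rewrite vE.
move/eqP; rewrite -subr_eq0 -RintegralB; first last.
- exact: integrable_polyfunM pG2 pG.
- exact: integrable_polyfunM pG1 pG.
- exact: measurable_std_simplex.
under eq_Rintegral do rewrite -mulrBl.
move=> /eqP /(polyfun_int_sqr_eq0 pG) H l l0 l1.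
rewrite comb_edge// l1 scale1r.
have l0' (i : nat) : (i < #|` F|)%N -> 0 < extend0 l F`_i.
  move=> iF; have F_i : F`_i \in F by exact: mem_nth.
  by rewrite -[F`_i]/(val [` F_i]%fset) extend0_val.
have cF : (0 < #|` F|)%N by rewrite cardfs_gt0.
apply: (H (\row_i extend0 l F`_i.+1)) => [i|].
  by rewrite mxE l0'// -[X in (_ < X)%N](prednK cF) ltnS.
under eq_bigr do rewrite mxE.
by rewrite -l1 (sum_extend0_vertices _ F0) ltrDr l0'.
Qed.

Lemma comb_vertex F (l : F -> R) : #|` F| == 1%N -> \sum_v l v = 1 -> comb l = F`_0.
Proof.
move=> F1 l1; rewrite comb_edge -?cardfs_gt0 ?(eqP F1)// l1 scale1r.
rewrite mulmx_sum_row big1 ?addr0// => i _; exfalso.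
by have := ltn_ord i; rewrite [X in (_ < X.-1)%N](eqP F1).
Qed.

(** Induction on the number of vertices of [F]. With two polynomials it serves both unisolvence,
    where [u2] is zero, and the matching of neighbouring pieces. *)
Lemma dofs_flat (normal : forall F, 'M[R]_(codim F, d)) K u1 u2 :
  (2 ^ d * r <= k)%N -> polyfun k u1 -> polyfun k u2 ->
  (forall F, subsimplex F K -> normal_frame (normal F)) ->
  (forall F, subsimplex F K -> dofs_eq r k normal F u1 u2) ->
  forall F, subsimplex F K -> forall x, aff_hull F x ->
    flat (max_order r (codim F)) (fun x => u1 x - u2 x) x.
Proof.
move=> kr pu1 pu2 NF dofE F.
have pu := polyfunB pu1 pu2.
move: {2}(#|` F|.+1) (ltnSn #|` F|) => m; elim: m F => // m IH F Fm FK x Fx.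
have flatE E : (E `<` F)%fset -> E != fset0 ->
    forall x, aff_hull E x -> flat (max_order r (codim E)) (fun x => u1 x - u2 x) x.
  move=> EF E0 y Ey; apply: IH => //.
    by have := fproper_ltn_card EF; lia.
  rewrite /subsimplex E0 (fsubset_trans (fproper_sub EF))//.
  by have /andP[] := FK.
have NFF := NF _ FK; have [F0 fF _ _] := NFF.
apply: (flat_normal NFF pu) Fx => theta thM y [l [l1 ->]].
have [c [cE cadm]] := normal_derive_coef kr NFF pu thM flatE.
pose g i := normal_derive (normal F) theta (if i then u1 else u2).
have gE : normal_derive (normal F) theta (fun x => u1 x - u2 x) =
    (fun x => g true x - g false x).
  by rewrite /g !normal_derive_iter (iter_deriveB _ pu1 pu2).
have pg i : polyfun k (g i).
  by rewrite /g normal_derive_iter; apply: polyfun_iter_deriveT; case: i.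
rewrite gE in cE *.
have vB := bubble_coef (g := fun x => g true x - g false x) fF cE cadm.
(* The test function is the difference itself; at a vertex the equality reads directly as a
   vanishing square. *)
have pos (l' : F -> R) : (forall v, 0 < l' v) -> \sum_v l' v = 1 ->
    g true (comb l') - g false (comb l') = 0.
  have := dofE _ FK theta thM _ vB; rewrite /dof.
  case: ifPn => F1; last by move/(simplex_int_bubble NFF (pg true) (pg false)); exact.
  move=> + _ l'1; rewrite (comb_vertex F1 l'1).
  have F_0 : F`_0 \in conv_hull F.
    rewrite inE; have := @std_simplex_conv_hull F 0 F0.
    rewrite mul0mx addr0; apply; split => [i|]; first by rewrite mxE.
    by rewrite big1// => i _; rewrite mxE.
  rewrite patchT// => /eqP; rewrite -subr_eq0 -mulrBl mulf_eq0 orbb.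
  by move/eqP.
(* Homogeneity extends the vanishing from positive coordinates of sum 1 to all positive ones, where
   monomials are independent. *)
have c0 : forall s, homog s -> c s = 0.
  apply: (monom_free (P := @homog _ _) (e := fun s v => s v : nat)).
    by move=> s s' _ _ ss'; apply/ffunP => v; apply: val_inj; exact: ss'.
  move=> z z0; pose A := \sum_v z v.
  have A0 : 0 < A.
    have /fset0Pn[x0 x0F] := F0.
    rewrite /A (bigD1 [` x0F]%fset)//= ltr_pwDl//.
    by apply: sumr_ge0 => v _; exact: ltW.
  have zA : \sum_v z v / A = 1 by rewrite -mulr_suml divff// gt_eqF.
  have := pos (fun v => z v / A) _ zA; rewrite cE// => cz.
  set n := (_ - _)%N in c cE cadm cz *.
  transitivity (A ^+ n * \sum_(s | @homog _ n s) c s * hmonom s (fun v => z v / A)); last first.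
    by rewrite cz ?mulr0// => v; rewrite divr_gt0.
  rewrite mulr_sumr; apply: eq_bigr => s /eqP sn; rewrite -[X in _ ^+ X]sn.
  rewrite mulrCA /hmonom -monomZ; congr (_ * _); apply: eq_bigr => v _.
  by rewrite mulrCA divff ?mulr1// gt_eqF.
by rewrite (cE l l1) big1// => s /c0 ->; rewrite mul0r.
Qed.

End degrees_of_freedom_determine_derivatives.

(** * Counting multi-indices *)

Section counting_multi_indices.

(** The counts [card_ord_partitions] and [card_partial_ord_partitions] concern tuples; a finite
    function is the tuple of its values. *)
Lemma card_ffun_tuple (I : finType) n (P : pred nat) :
  #|[pred f : {ffun I -> 'I_n.+1} | P (\sum_i f i)%N]| =
  #|[set t : #|I|.-tuple 'I_n.+1 | P (\sum_(i <- t) i)%N]%SET|.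
Proof.
rewrite -[LHS]sum1_card -[RHS]sum1_card (reindex (@Finfun I 'I_n.+1)) /=; last first.
  by exists (@fgraph I 'I_n.+1) => t _; [exact: FinfunK|exact: fgraphK].
apply: eq_bigl => t; rewrite !inE /=; congr P.
by rewrite -[in RHS](FinfunK t) -codom_ffun big_map big_enum.
Qed.

Lemma card_homog (I : finType) n m : #|I| = m.+1 ->
  #|[pred f : {ffun I -> 'I_n.+1} | homog f]| = 'C(m + n, m).
Proof.
move=> cI; rewrite (@card_ffun_tuple I n (fun s => s == n)) cI.
exact: card_ord_partitions.
Qed.

Lemma card_degree_le n m :
  #|[pred f : {ffun 'I_m -> 'I_n.+1} | (\sum_i f i <= n)%N]| = 'C(m + n, m).
Proof.
rewrite (@card_ffun_tuple _ n (fun s => (s <= n)%N)) card_ord.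
exact: card_partial_ord_partitions.
Qed.

(** A function on [K] is a pair of functions on [X] and [Y]; the count is by fibres over the second
    component. *)
Lemma sum_ffun_split (X Y K T : finType) (g : X + Y -> K)
    (Q : {ffun X -> T} -> {ffun Y -> T} -> bool) :
  bijective g ->
  #|[pred f : {ffun K -> T} | Q [ffun x => f (g (inl x))] [ffun y => f (g (inr y))]]| =
  (\sum_(b : {ffun Y -> T}) #|[pred a | Q a b]|)%N.
Proof.
move=> [g' gK g'K]; rewrite -sum1_card.
pose h (p : {ffun Y -> T} * {ffun X -> T}) : {ffun K -> T} :=
  [ffun u => match g' u with inl x => p.2 x | inr y => p.1 y end].
pose h' (f : {ffun K -> T}) := ([ffun y => f (g (inr y))], [ffun x => f (g (inl x))]).
have hK : cancel h h'.
  by case=> b a; congr pair; apply/ffunP => z; rewrite !ffunE gK.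
have h'K : cancel h' h.
  move=> f; apply/ffunP => u; rewrite ffunE; case E : (g' u) => [x|y]; rewrite ffunE -E g'K//.
rewrite (reindex h) /=; last by exists h' => p _; [exact: hK|exact: h'K].
under [RHS]eq_bigr do rewrite -sum1_card.
rewrite pair_big_dep /=; apply: eq_bigl => -[b a]; rewrite !inE.
by congr Q; apply/ffunP => z; rewrite !ffunE gK.
Qed.

(** A total of at most [M] already bounds each value. [dof_count] uses the range [M], exponents on
    the whole simplex the range [k]. *)
Lemma sum_ffun_bound (Y : finType) M k (f : nat -> nat) : (M <= k)%N ->
  (\sum_(t : {ffun Y -> 'I_k.+1} | \sum_y t y <= M) f (\sum_y t y) =
   \sum_(t : {ffun Y -> 'I_M.+1} | \sum_y t y <= M) f (\sum_y t y))%N.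
Proof.
move=> Mk.
have le a (t : {ffun Y -> 'I_a.+1}) y : (t y <= \sum_y t y)%N by rewrite (bigD1 y)//= leq_addr.
rewrite (reindex_onto (fun t : {ffun Y -> 'I_M.+1} => [ffun y => inord (t y) : 'I_k.+1])
  (fun t : {ffun Y -> 'I_k.+1} => [ffun y => inord (t y) : 'I_M.+1])) /=; last first.
  move=> t tM; apply/ffunP => y; rewrite !ffunE; apply: val_inj.
  by rewrite /= inordK inordK ?ltnS// (leq_trans (le _ t y)) ?(leq_trans tM).
have sumE (t : {ffun Y -> 'I_M.+1}) :
    (\sum_y [ffun y => inord (t y) : 'I_k.+1] y = \sum_y t y)%N.
  apply: eq_bigr => y _; rewrite ffunE inordK// ltnS (leq_trans _ Mk)//.
  by rewrite -ltnS.
apply: eq_big => [t|t _]; rewrite sumE//.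
case: leqP => //= _; apply/eqP/ffunP => y; rewrite !ffunE; apply: val_inj => /=.
by rewrite !inordK// ltnS (leq_trans _ Mk)// -ltnS.
Qed.

End counting_multi_indices.

(** * Assignment of each exponent to a unique subsimplex *)

Section assignment_of_multi_indices.
Variables (I : finType) (r k d : nat).
Hypothesis card_I : #|I| = d.+1.
Hypothesis kr : (2 ^ d * r + 1 <= k)%N.
Variable al : I -> nat.
Hypothesis al_k : (\sum_i al i = k)%N.

Let wt (G : {set I}) := (\sum_(i in G) al i)%N.

(** [A] holds the vertices of the subsimplex in charge of [al]; maximality of the opposite set is
    phrased as minimality of [A]. *)
Definition assigned (A : {set I}) : bool :=
  [&& A != finset.set0, (wt (~: A) <= max_order r #|~: A|)%N &
   [forall B : {set I}, (B != finset.set0) && (B \proper A) ==>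
     (max_order r #|~: B| < wt (~: B))%N]].

(** Both orders are at most half of [max_order r c], which doubles with each codimension; for
    [c = 1] both are zero. *)
Lemma max_orderD a b c : (a < c)%N -> (b < c)%N ->
  (max_order r a + max_order r b <= max_order r c)%N.
Proof.
case: c => // c; rewrite !ltnS /= => ac bc.
have H s : (s <= c)%N -> (max_order r s <= 2 ^ c.-1 * r)%N /\ (c = 0%N -> max_order r s = 0%N).
  case: s => [//|s] sc /=; split; last by move=> c0; rewrite c0 in sc.
  by rewrite leq_mul2r leq_pexp2l ?orbT//; lia.
have [Ha Ha0] := H _ ac; have [Hb Hb0] := H _ bc.
case: c Ha Hb Ha0 Hb0 {ac bc H} => [_ _ /(_ erefl) -> /(_ erefl) ->//|c /= Ha Hb _ _].
by rewrite expnS; lia.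
Qed.

Lemma wtU (G H : {set I}) : (wt (G :|: H) <= wt G + wt H)%N.
Proof.
rewrite /wt !(big_mkcond (fun i => i \in _)) -big_split /=; apply: leq_sum => i _.
by rewrite inE; case: (i \in G); case: (i \in H) => //=; rewrite ?leq_addr ?addn0.
Qed.

(** For incomparable sets, [wtU] and [max_orderD] show that [A :&: B] also meets the weight bound,
    against the minimality of [A]. *)
Lemma assigned_meet (A B : {set I}) : assigned A -> assigned B -> A = A :&: B.
Proof.
move=> /and3P[A0 wA mA] /and3P[B0 wB _].
have [AB|AB] := boolP (A \subset B); first by rewrite (finset.setIidPl AB).
have [BA|BA] := boolP (B \subset A).
  rewrite (finset.setIidPr BA); apply/eqP; apply: contraTT isT => AB'.
  have := forallP mA B; rewrite B0 finset.properEneq BA andbT eq_sym AB' /=.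
  by rewrite ltnNge wB.
have wAB : (wt (~: (A :&: B)) <= max_order r #|~: (A :&: B)|)%N.
  rewrite finset.setCI; apply: leq_trans (wtU _ _) _.
  apply: leq_trans (leq_add wA wB) _; apply: max_orderD; apply: fintype.proper_card.
    by rewrite finset.properUl// finset.setCS.
  by rewrite finset.properUr// finset.setCS.
(* An empty intersection would put the whole weight [k] in the complement, above
   [max_order r d.+1 = 2 ^ d * r]. *)
have AB0 : A :&: B != finset.set0.
  apply: contraTneq wAB => ->; rewrite -ltnNge finset.setC0 cardsT card_I /wt.
  rewrite (eq_bigl xpredT) ?al_k => [|i]; last by rewrite inE.
  by rewrite /=; lia.
have := forallP mA (A :&: B); rewrite AB0 /= ltnNge wAB implybF fintype.properE finset.subsetIl /=.
by rewrite finset.subsetI subxx AB.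
Qed.

(** The complement of a largest proper set within the weight bound works; the empty set shows that
    there is one. *)
Lemma assigned_exists : exists A, assigned A.
Proof.
pose P (G : {set I}) := (G != [set: I]%SET) && (wt G <= max_order r #|G|)%N.
have P0 : P finset.set0.
  rewrite /P /wt big_set0 andbT; apply/eqP => /(congr1 (fun A : {set I} => #|A|)).
  by rewrite cards0 cardsT card_I.
have [G /andP[GT wG] maxG] := @arg_maxnP _ finset.set0 P (fun G => #|G|) P0.
exists (~: G); rewrite /assigned finset.setCK wG /=; apply/andP; split.
  by apply: contra GT => /eqP G0; rewrite -[G]finset.setCK G0 finset.setC0.
apply/forallP => B; apply/implyP => /andP[B0 BG]; rewrite ltnNge; apply/negP => wB.
have /maxG : P (~: B).
  rewrite /P wB andbT; apply: contra B0 => /eqP BT.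
  by rewrite -[B]finset.setCK BT finset.setCT.
by rewrite /= leqNgt (fintype.proper_card _)// -finset.properC finset.setCK.
Qed.

Lemma assigned_unique : (\sum_(A | assigned A) 1 = 1)%N.
Proof.
have [A HA] := assigned_exists.
rewrite (big_pred1 A)// => B; apply/idP/eqP => [HB|->//].
by rewrite (assigned_meet HB HA) finset.setIC -(assigned_meet HA HB).
Qed.

End assignment_of_multi_indices.

(** * The number of degrees of freedom and unisolvence *)

Section dimension_of_polynomial_space.
Context {R : realType} {d : nat}.
Variables r k : nat.
Hypothesis kr : (2 ^ d * r + 1 <= k)%N.
Implicit Types (F K : {fset 'rV[R]_d}).

Lemma fdim_polys : fdim (@polys R d k) = 'C(d + k, d).
Proof.
rewrite -card_degree_le.
pose b (s : {ffun 'I_d -> 'I_k.+1}) (x : 'rV[R]_d) := \prod_i x 0 i ^+ s i.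
rewrite -(fdim_fspan (b := b)) => [|c c0].
  congr fdim; congr fspan; apply/seteqP; split => [_ [a [ak ->]]|_ [s sk <-]]; last first.
    by exists (fun i => s i : nat).
  have ale i : (a i < k.+1)%N by rewrite ltnS (leq_trans _ ak)// (bigD1 i)//= leq_addr.
  exists [ffun i => inord (a i)].
    rewrite /= (leq_trans _ ak)//; apply: leq_sum => i _.
    by rewrite ffunE inordK.
  by apply/funext => x; apply: eq_bigr => i _; rewrite ffunE inordK.
apply: (monom_free (e := fun (s : {ffun 'I_d -> 'I_k.+1}) i => s i : nat)).
  by move=> s s' _ _ ss'; apply/ffunP => v; apply: val_inj; exact: ss'.
move=> y _; rewrite -[RHS](c0 (\row_i y i)); apply: eq_bigr => s _.
by congr (_ * _); apply: eq_bigr => i _; rewrite mxE.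
Qed.

Lemma fdim_bubble F n : F != fset0 -> aff_free F ->
  fdim (bubble r k F n) =
  #|[pred s : {ffun F -> 'I_k.+1} | `[< admissible r k n (fun v => s v) >] ]|.
Proof.
move=> F0 fF.
pose b (s : {ffun F -> 'I_k.+1}) := (fun x => \prod_v bary F x v ^+ s v) \_ (conv_hull F).
rewrite -(fdim_fspan (b := b)) => [|c c0].
  congr fdim; congr fspan; apply/seteqP;
    split => [_ [a [ak ->]]|_ [s /= /asboolP sk <-]]; last first.
    by exists (fun i => s i : nat).
  have ale i : (a i < k.+1)%N.
    by rewrite ltnS -(proj1 ak) (bigD1 i)//= -addnA leq_addr.
  have aE : (fun i => [ffun i => inord (a i) : 'I_k.+1] i : nat) = a.
    by apply/funext => i; rewrite ffunE inordK.
  exists [ffun i => inord (a i)]; first by rewrite /= aE; exact/asboolP.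
  rewrite /b; congr patch; apply/funext => x; apply: eq_bigr => i _.
  by rewrite ffunE inordK.
apply: (monom_free (e := fun (s : {ffun F -> 'I_k.+1}) i => s i : nat)).
  by move=> s s' _ _ ss'; apply/ffunP => v; apply: val_inj; exact: ss'.
move=> y y0; pose A := \sum_v y v.
have A0 : 0 < A.
  have /fset0Pn[x0 x0F] := F0.
  rewrite /A (bigD1 [` x0F]%fset)//= ltr_pwDl//.
  by apply: sumr_ge0 => v _; exact: ltW.
have yA : \sum_v y v / A = 1 by rewrite -mulr_suml divff// gt_eqF.
(* [bary] recovers coordinates of sum 1 only, so [y] is normalized by [A]; all admissible exponents
   have degree [k - n], so one power of [A] compensates. *)
transitivity (A ^+ (k - n) * \sum_(s : {ffun F -> 'I_k.+1} | `[< admissible r k n (fun v => s v) >])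
    c s * b s (comb (fun v => y v / A))); last by rewrite c0 mulr0.
rewrite mulr_sumr; apply: eq_bigr => s /asboolP[sn _].
rewrite mulrCA; congr (_ * _); rewrite /b patchT; last first.
  by rewrite inE; exists (fun v => y v / A); split => // v; rewrite divr_ge0 ?ltW.
rewrite -[X in (X - n)%N]sn addnK -prodrXr -big_split; apply: eq_bigr => v _ /=.
by rewrite baryE// -exprMn mulrCA divff ?mulr1// gt_eqF.
Qed.

(** A nonempty proper [S] in [A] corresponds to the nonempty proper subset [B] of [A] that it leaves
    out: the complement of [B] consists of [S] and the vertices outside [A], which matches both
    weights and codimensions. *)
Lemma admissible_assigned K (A : {set K}) (al : K -> nat) : #|` K| = d.+1 ->
  A != finset.set0 -> (\sum_(u in ~: A) al u <= max_order r #|~: A|)%N ->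
  `[< admissible r k (\sum_(u in ~: A) al u) (fun v => al (fincl (vset_sub A) v)) >] =
  (\sum_u al u == k)%N && assigned r al A.
Proof.
move=> cK A0 wA.
set p := fincl (vset_sub A).
have pinj : injective p by exact: fincl_inj.
have pA (S : {set vset A}) : p @: S \subset A.
  by apply/fintype.subsetP => _ /imsetP[v _ ->]; rewrite -in_vset /p /=; exact: valP.
have pT : p @: [set: vset A]%SET = A.
  apply/eqP; rewrite eqEcard pA card_imset// cardsT -card_vset cardfE.
  exact: leqnn.
have codimA : codim (vset A) = #|~: A|.
  by rewrite /codim card_vset -cK cardfE [RHS]cardsCs finset.setCK.
have sumS (f : K -> nat) (S : {set vset A}) :
    (\sum_(u in ~: (A :\: p @: S)) f u = \sum_(v in S) f (p v) + \sum_(u in ~: A) f u)%N.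
  rewrite (bigID (mem A)) /=; congr addn; last first.
    by apply: eq_bigl => u; rewrite !inE; case: (u \in A); rewrite ?andbF ?andbT.
  rewrite -(big_imset _ (in2W pinj)) /=; apply: eq_bigl => u; rewrite !inE negb_and negbK.
  by case: (boolP (u \in p @: S)) => [/(fintype.subsetP (pA S)) ->|_] //=; rewrite andNb.
have cardS (S : {set vset A}) : #|~: (A :\: p @: S)| = (#|S| + #|~: A|)%N.
  by rewrite -!sum1_card sumS.
have sumT : (\sum_u al u = \sum_v al (p v) + \sum_(u in ~: A) al u)%N.
  transitivity (\sum_(u in ~: (A :\: p @: [set: vset A]%SET)) al u)%N.
    by apply: eq_bigl => u; rewrite pT !inE andNb.
  by rewrite sumS; congr addn; apply: eq_bigl => v; rewrite inE.
apply/asboolP/andP => [[sk adm]|[/eqP sk asg]].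
  rewrite sumT sk; split => //; rewrite /assigned A0 wA /=.
  apply/forallP => B; apply/implyP => /andP[B0 BA].
  pose S := (p @^-1: (A :\: B))%SET.
  have pS : p @: S = A :\: B.
    apply/setP => u; apply/imsetP/idP => [[v vS ->]|uAB]; first by rewrite inE in vS.
    have : u \in p @: [set: vset A]%SET by rewrite pT; move: uAB; rewrite inE => /andP[].
    by move=> /imsetP[v _ uE]; exists v; rewrite // inE -uE.
  have BE : A :\: p @: S = B.
    by rewrite pS finset.setDDr finset.setDv finset.set0U; exact/finset.setIidPr/fintype.proper_sub.
  have S0 : (0 < #|S|)%N.
    by rewrite -(card_imset _ pinj) pS card_gt0 finset.setD_eq0 proper_subn.
  have SF : (#|S| < #|` vset A|)%N.
    rewrite -(card_imset _ pinj) pS card_vset proper_card// fintype.properE finset.subsetDl /=.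
    apply: contraNN B0 => /fintype.subsetP AB; rewrite -finset.subset0.
    apply/fintype.subsetP => u uB; have uA := fintype.subsetP (fintype.proper_sub BA) _ uB.
    by have := AB _ uA; rewrite inE uB.
  have := adm S; rewrite S0 SF => /(_ isT).
  rewrite -BE sumS cardS codimA.
  by rewrite -[X in max_order r X](prednK (ltn_addr _ S0)) /= subn1.
rewrite /admissible -sumT; split=> // S /andP[S0 SF].
have /and3P[_ _ /forallP/(_ (A :\: p @: S))/implyP] := asg.
rewrite sumS cardS codimA -[X in max_order r X](prednK (ltn_addr _ S0)) /= subn1.
apply; apply/andP; split.
  rewrite finset.setD_eq0; apply: contraL SF => AS.
  by rewrite -leqNgt card_vset -(card_imset _ pinj) subset_leq_card.
rewrite fintype.properE finset.subsetDl /=; apply/fintype.subsetPn.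
have /card_gt0P[v vS] := S0.
by exists (p v); rewrite ?inE ?imset_f ?(fintype.subsetP (pA S))// imset_f.
Qed.

Lemma sum_subsimplices K (f : {fset 'rV[R]_d} -> nat) :
  (\sum_(F <- fpowerset K | subsimplex F K) f F =
   \sum_(A : {set K} | A != finset.set0) f (vset A))%N.
Proof.
have pm : perm_eq (fpowerset K) [seq vset A | A <- enum {set K}].
  apply: uniq_perm; first exact: fset_uniq.
    rewrite map_inj_uniq ?enum_uniq// => A B AB.
    by rewrite -(fsub_vset A) AB fsub_vset.
  move=> F; rewrite fpowersetE; apply/idP/mapP => [FK|[A _ ->]]; last exact: vset_sub.
  by exists (fsub K F); rewrite ?mem_enum// vset_fsub.
rewrite (perm_big _ pm) /= big_map big_enum_cond /=; apply: eq_bigl => A.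
by rewrite /subsimplex vset_sub andbT -cardfs_gt0 card_vset card_gt0.
Qed.

(** There are as many normals as vertices outside [A], so [g] lets the part of [al] off [A] be read
    as [theta] and the part on [A] as an exponent of a bubble. *)
Lemma dof_count_face K (A : {set K}) : #|` K| = d.+1 -> aff_free K -> A != finset.set0 ->
  (\sum_(theta : {ffun 'I_(codim (vset A)) -> 'I_(max_order r (codim (vset A))).+1}
        | \sum_i theta i <= max_order r (codim (vset A)))
      fdim (bubble r k (vset A) (\sum_i theta i)))%N =
  #|[pred al : {ffun K -> 'I_k.+1} | homog al && assigned r (fun u => al u) A]|.
Proof.
move=> cK fK A0; set F := vset A.
have F0 : F != fset0 by rewrite -cardfs_gt0 card_vset card_gt0.
have fF : aff_free F by exact: aff_freeS (vset_sub A) fK.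
set M := max_order r (codim F).
have Mk : (M <= k)%N.
  by rewrite (leq_trans (max_order_le r F0))// (leq_trans _ kr)// leq_addr.
have codimA : codim F = #|~: A|.
  by rewrite /codim card_vset -cK cardfE [RHS]cardsCs finset.setCK.
rewrite -(@sum_ffun_bound _ M k (fun n => fdim (bubble r k F n)) Mk).
pose g (z : F + 'I_(codim F)) : K := match z with
  | inl v => fincl (vset_sub A) v
  | inr i => enum_val (cast_ord codimA i)
  end.
have gl v : g (inl v) \in A by rewrite -in_vset /=; exact: valP.
have gr i : g (inr i) \notin A by have := enum_valP (cast_ord codimA i); rewrite inE.
have gbij : bijective g.
  apply: inj_card_bij.
    move=> [v|i] [w|j] gE.
    - by congr inl; exact: fincl_inj gE.
    - by have := gl v; rewrite gE (negPf (gr j)).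
    - by have := gl w; rewrite -gE (negPf (gr i)).
    - by congr inr; apply: (can_inj (cast_ordK codimA)); exact: enum_val_inj gE.
  have cF : #|{: F}| = #|A| by rewrite -cardfE card_vset.
  by rewrite card_sum card_ord codimA cF cardsC.
pose Q (a : {ffun F -> 'I_k.+1}) (b : {ffun 'I_(codim F) -> 'I_k.+1}) :=
  (\sum_i b i <= M)%N && `[< admissible r k (\sum_i b i) (fun v => a v) >].
transitivity (\sum_(b : {ffun 'I_(codim F) -> 'I_k.+1}) #|[pred a | Q a b]|)%N.
  rewrite big_mkcond; apply: eq_bigr => b _.
  rewrite /Q; case: leqP => bM; last by rewrite eq_card0.
  by rewrite fdim_bubble.
rewrite -(sum_ffun_split Q gbij); apply: eq_card => al; rewrite !inE /Q.
have sumr : (\sum_i [ffun i => al (g (inr i))] i = \sum_(u in ~: A) al u)%N.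
  rewrite [RHS]big_enum_val (reindex (cast_ord codimA)); last first.
    by exists (cast_ord (esym codimA)) => i _; [exact: cast_ordK|exact: cast_ordKV].
  by apply: eq_bigr => i _; rewrite ffunE.
rewrite sumr /homog.
rewrite (_ : (fun v => [ffun x => al (g (inl x))] v : nat) =
  (fun v => al (fincl (vset_sub A) v) : nat)); last by apply/funext => v; rewrite ffunE.
have [wA|wA] := leqP; last first.
  by rewrite /assigned -codimA leqNgt wA /= andbF andbF.
have {}wA : (\sum_(u in ~: A) al u <= max_order r #|~: A|)%N by rewrite -codimA.
by rewrite (admissible_assigned cK A0 wA).
Qed.

(** Double counting of pairs of an exponent and its assigned vertex set. *)
Lemma dof_count_polys K : #|` K| = d.+1 -> aff_free K -> dof_count r k K = fdim (@polys R d k).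
Proof.
move=> cK fK.
have cK' : #|{: K}| = d.+1 by rewrite -cardfE.
rewrite fdim_polys -(card_homog _ cK') /dof_count sum_subsimplices.
under eq_bigr => A A0 do rewrite dof_count_face//.
under eq_bigr => A A0 do rewrite -sum1_card big_mkcondr.
rewrite big_mkcond -sum1_card.
rewrite (eq_bigr (fun A => \sum_(al : {ffun K -> 'I_k.+1} | homog al)
   (if assigned r (fun u => al u) A then 1 else 0))%N); last first.
  move=> A _; case: ifPn => // /negPn A0; rewrite big1// => al _.
  by rewrite /assigned A0.
rewrite exchange_big /=; apply: eq_bigr => al hal.
by rewrite -big_mkcond (assigned_unique cK' kr (eqP hal)).
Qed.

Lemma unisolvent_simplex K (normal : forall F, 'M[R]_(codim F, d)) :
  #|` K| = d.+1 -> affine_indep K ->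
  (forall F, subsimplex F K -> normal_frame (normal F)) -> unisolvent r k normal K.
Proof.
move=> cK /aff_free_row_free fK NF; split; first exact: dof_count_polys.
move=> u pu uE; apply/funext => x.
have K0 : K != fset0 by rewrite -cardfs_gt0 cK.
have KK : subsimplex K K by rewrite /subsimplex K0 fsubset_refl.
(* In codimension 0 the frame has no rows, so the edges span all directions. *)
have Kx : aff_hull K x.
  have cK0 : codim K = 0%N by rewrite /codim cK subnn.
  have [a [b xE]] := normal_frame_decomp (x - K`_0) (NF _ KK).
  rewrite -[x](subrK K`_0) xE addrC.
  have -> : b *m normal K = 0.
    by rewrite mulmx_sum_row big1// => i _; have := ltn_ord i; rewrite {2}cK0.
  rewrite addr0; apply: aff_hull_edge => //.
  have [l [[l1 lc _] _]] := edge_coord 1 0 K0.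
  by exists l; rewrite lc mul0mx addr0 scale1r.
have dof0 F theta v : dof normal (F := F) theta v (fun=> 0) = 0.
  rewrite /dof normal_derive_iter iter_derive0; case: ifP => _; first by rewrite mul0r.
  rewrite /simplex_int; under eq_Rintegral do rewrite mul0r.
  by rewrite Rintegral_cst ?mul0r ?mulr0//; exact: measurable_std_simplex.
have := @dofs_flat R d r k normal K u (fun=> 0) _ (polys_polyfun pu)
  (polyfun_cst _ _ _) NF _ K KK x Kx [::] isT.
rewrite /= subr0; apply; first by rewrite (leq_trans _ kr)// leq_addr.
by move=> F FK theta thM v vB; rewrite uE// dof0.
Qed.

End dimension_of_polynomial_space.

(** * Gluing polynomial pieces into a function of class [Cr] *)

Section piecewise_polynomials.
Context {R : realType} {d : nat} {J : choiceType}.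
Variables (Omega : set 'rV[R]_d) (T : set J) (D : J -> set 'rV[R]_d).
(** Near [x] finitely many pieces suffice to cover, and all of them contain [x]. *)
Hypothesis loc : forall x, Omega x -> exists X : {fset J},
  (forall j, j \in X -> T j /\ D j x) /\
  nbhs x [set y | Omega y /\ exists j, j \in X /\ D j y].

(** Every nearby value of [g] is a value of one of finitely many pieces, all of which tend to
    [g x]. *)
Lemma continuous_glue k (g : 'rV[R]_d -> R) (q : J -> 'rV[R]_d -> R) :
  (forall j, T j -> polyfun k (q j)) ->
  (forall j x, Omega x -> T j -> D j x -> g x = q j x) ->
  forall x, Omega x -> {for x, continuous g}.
Proof.
move=> pq gq x Ox; have [X [XT near_X]] := loc Ox.
apply/(@cvgrPdist_lt _ _ _ (nbhs x) (nbhs_filter x)) => e e0.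
have cq : \forall y \near x, forall j : X, `|q (val j) x - q (val j) y| < e.
  apply: (@filter_forall _ _ _ (nbhs x)) => j; have [Tj _] := XT _ (valP j).
  by have /cvgrPdist_lt := @polyfun_continuous _ _ _ _ (pq _ Tj) x; exact.
near=> y.
have [Oy [j [jX Djy]]] : Omega y /\ exists j, j \in X /\ D j y by near: y.
have [Tj Djx] := XT _ jX.
rewrite (gq j)// (gq j _ Oy)//.
have /(_ [` jX]%fset) : forall j : X, `|q (val j) x - q (val j) y| < e by near: y.
exact.
Unshelve. all: by end_near. Qed.

(** Each small difference quotient of [g] is that of one of finitely many pieces through [x], whose
    limits agree by hypothesis. *)
Lemma derive_glue k (g : 'rV[R]_d -> R) (q : J -> 'rV[R]_d -> R) w :
  (forall j, T j -> polyfun k (q j)) ->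
  (forall j x, Omega x -> T j -> D j x -> g x = q j x) ->
  (forall i j x, T i -> T j -> D i x -> D j x -> ddir w (q i) x = ddir w (q j) x) ->
  forall j x, Omega x -> T j -> D j x -> is_derive x w g (ddir w (q j) x).
Proof.
move=> pq gq dq j0 x Ox Tj0 Dj0; have [X [XT near_X]] := loc Ox.
set L := ddir w (q j0) x.
suff cv : (fun h : R => h^-1 *: ((g \o shift x) (h *: w) - g x)) @ 0^' --> L.
  by apply: DeriveDef; [apply/cvg_ex; exists L|exact: cvg_lim cv].
apply/cvgrPdist_lt => e e0.
have cq : \forall h \near 0^', forall j : X,
    `|L - h^-1 *: ((q (val j) \o shift x) (h *: w) - q (val j) x)| < e.
  apply: filter_forall => j; have [Tj Djx] := XT _ (valP j).
  have dj : derivable (q (val j)) x w := polyfun_derivable (pq _ Tj).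
  have : (fun h : R => h^-1 *: ((q (val j) \o shift x) (h *: w) - q (val j) x)) @ 0^' --> L.
    by rewrite /L (dq _ _ _ Tj0 Tj Dj0 Djx).
  by move/cvgrPdist_lt; exact.
have cl : (fun h : R => h *: w + x) @ nbhs (0 : R) --> x.
  have : (fun h : R => h *: w + x) @ nbhs (0 : R) --> 0 *: w + x.
    by apply: cvgD; [exact: scalel_continuous|exact: cvg_cst].
  by rewrite scale0r add0r.
near=> h.
have [Oy [j [jX Djy]]] : Omega (h *: w + x) /\ exists j, j \in X /\ D j (h *: w + x).
  near: h; apply: nbhs_dnbhs; exact: cl near_X.
have [Tj Djx] := XT _ jX.
rewrite /= (gq j _ Oy)// (gq j x)//.
have /(_ [` jX]%fset) : forall j : X,
  `|L - h^-1 *: ((q (val j) \o shift x) (h *: w) - q (val j) x)| < e by near: h.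
exact.
Unshelve. all: by end_near. Qed.

(** Induction on [r]: each partial derivative of [g] is glued from those of the pieces, which agree
    to one order less. *)
Lemma Cr_glue k r (g : 'rV[R]_d -> R) (q : J -> 'rV[R]_d -> R) :
  (forall j, T j -> polyfun k (q j)) ->
  (forall j x, Omega x -> T j -> D j x -> g x = q j x) ->
  (forall i j x, T i -> T j -> D i x -> D j x -> forall ws, (size ws <= r)%N ->
     iter_derive ws (q i) x = iter_derive ws (q j) x) ->
  Cr r Omega g.
Proof.
elim: r g q => [|r IH] g q pq gq dq; split; try exact: (continuous_glue pq gq).
  by [].
move=> a.
have dg j (x : 'rV[R]_d) := derive_glue (w := 'e_a) pq gq (fun i j x Ti Tj Di Dj =>
  dq i j x Ti Tj Di Dj [:: 'e_a] isT) (j := j) (x := x).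
split.
  move=> x Ox; have [X [XT near_X]] := loc Ox.
  have [_ [j [jX _]]] := nbhs_singleton near_X; have [Tj Djx] := XT _ jX.
  by have [] := dg _ _ Ox Tj Djx.
apply: (IH _ (fun j => ddir 'e_a (q j))).
- by move=> j Tj; apply: polyfun_deriveT; exact: pq.
- by move=> j x Ox Tj Djx; have [_] := dg _ _ Ox Tj Djx.
- move=> i1 j1 x Ti Tj Di Dj ws wsr.
  have := dq _ _ _ Ti Tj Di Dj (ws ++ [:: 'e_a]).
  by rewrite !iter_derive_cat size_cat /= addn1; exact.
Qed.

End piecewise_polynomials.

(** * Local structure of a triangulation and agreement of pieces *)

Section triangulated_domains.
Context {R : realType} {d : nat}.
Implicit Types (F K : {fset 'rV[R]_d}).

(** In full dimension the edge matrix is invertible, so a simplex is cut out by finitely many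
    inequalities between affine functions. *)
Lemma conv_hull_coord K : #|` K| = d.+1 -> affine_indep K ->
  exists f : 'I_(#|` K|.-1) -> 'rV[R]_d -> R, (forall i, polyfun 1 (f i)) /\
    forall x, conv_hull K x <-> std_simplex (\row_i f i x).
Proof.
move=> cK rK; have K0 : K != fset0 by rewrite -cardfs_gt0 cK.
set P := pinvmx (edge_mx K).
exists (fun i x => (- K`_0 *m P + x *m P) 0 i); split=> [i|x].
  apply: (@polyfun_affine _ _ _ _ (fun t : 'rV[R]_(#|` K|.-1) => t 0 i) (- K`_0 *m P) P).
  by apply: polyfun_ext (polyfun_coordM i (polyfun_cst _ 0 1)) => t; rewrite mulr1.
have -> : \row_i (- K`_0 *m P + x *m P) 0 i = (x - K`_0) *m P.
  by apply/rowP => i; rewrite mxE -mulmxDl addrC.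
split=> [[l [l0 l1 ->]]|].
  rewrite -/(comb l) comb_edge// l1 scale1r addrC addKr mulmxKp//.
  have e0 y : 0 <= extend0 l y by rewrite /extend0; case: insubP => //= u _ _; exact: l0.
  split=> [i|]; first by rewrite mxE.
  under eq_bigr do rewrite mxE.
  by rewrite -l1 sum_extend0_vertices// lerDr.
move=> /(std_simplex_conv_hull K0); rewrite mulmxKpV; first by rewrite addrC subrK.
apply: submx_full; rewrite /row_full; move/eqP: rK => ->.
by rewrite cK.
Qed.

(** A violated inequality remains violated nearby: either a negative coordinate or a sum above 1. *)
Lemma near_notin_conv_hull K x : #|` K| = d.+1 -> affine_indep K ->
  ~ conv_hull K x -> nbhs x [set y | ~ conv_hull K y].
Proof.
move=> cK rK Kx; have [f [pf fE]] := conv_hull_coord cK rK.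
have cf i : continuous (f i) by exact: polyfun_continuous (pf i).
have [[i fi]|fge0] := pselect (exists i, f i x < 0).
  near=> y; rewrite /= fE => -[/(_ i) + _]; rewrite mxE leNgt => /negP; apply.
  by near: y; exact: (cvgr_lt _ (cf i x)).
have sf : 1 < \sum_i f i x.
  rewrite ltNge; apply/negP => le1; apply: Kx; apply/fE; split=> [i|].
    by rewrite mxE leNgt; apply/negP => fi; apply: fge0; exists i.
  by under eq_bigr do rewrite mxE.
have csf : continuous (fun y => \sum_i f i y).
  by apply: (polyfun_continuous (n := 1)); apply: polyfun_sum => i _.
near=> y; rewrite /= fE => -[_]; under eq_bigr do rewrite mxE.
rewrite leNgt => /negP; apply.
by near: y; exact: (cvgr_gt _ (csf x)).
Unshelve. all: by end_near. Qed.

Variables (Omega : set 'rV[R]_d) (T : set {fset 'rV[R]_d}).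
Hypothesis OT : triangulation Omega T.

(** Of the finitely many simplices near [x], those missing [x] are avoided on a smaller
    neighbourhood. *)
Lemma triangulation_near x : open Omega -> Omega x -> exists X : {fset {fset 'rV[R]_d}},
  (forall K, K \in X -> T K /\ conv_hull K x) /\
  nbhs x [set y | Omega y /\ exists K, K \in X /\ conv_hull K y].
Proof.
move=> oO Ox; have [U Ux /finite_fsetP[X0 X0E]] := triangulation_locally_finite OT Ox.
exists [fset K in X0 | `[< conv_hull K x >]]%fset; split=> [K|].
  rewrite !inE /= => /andP[KX /asboolP Kx]; split => //.
  have : [set` X0] K by [].
  by rewrite -X0E => -[].
have nX : nbhs x [set y | forall K : X0, ~ conv_hull (val K) x -> ~ conv_hull (val K) y].
  apply: (@filter_forall _ _ _ (nbhs x)) => K.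
  have [Kx|Kx] := pselect (conv_hull (val K) x); first exact: nearW.
  have : [set` X0] (val K) by exact: (valP K).
  rewrite -X0E => -[TK _]; have [cK rK] := triangulation_simplex OT TK.
  by apply: filterS (near_notin_conv_hull cK rK Kx) => y Ky _.
near=> y.
have Oy : Omega y by near: y; exact: open_nbhs_nbhs.
split=> //; have [K TK Ky] := triangulation_cover OT Oy.
have KX0 : K \in X0.
  suff : [set` X0] K by [].
  by rewrite -X0E; split=> //; exists y; split=> //; near: y.
exists K; split=> //; rewrite !inE /= KX0; apply/asboolP; apply: contrapT => Kx.
have : forall K : X0, ~ conv_hull (val K) x -> ~ conv_hull (val K) y by near: y.
by move=> /(_ [` KX0]%fset Kx) /=.
Unshelve. all: by end_near. Qed.

Lemma pieces_agree r k (normal : forall F, 'M[R]_(codim F, d))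
    (p : {fset 'rV[R]_d} -> 'rV[R]_d -> R) :
  (2 ^ d * r <= k)%N -> normal_frames T normal ->
  (forall K, T K -> polys k (p K)) ->
  (forall F K1 K2, T K1 -> T K2 -> subsimplex F K1 -> subsimplex F K2 ->
    (#|` F| <= d)%N -> dofs_eq r k normal F (p K1) (p K2)) ->
  forall K1 K2 x, T K1 -> T K2 -> conv_hull K1 x -> conv_hull K2 x ->
  forall ws, (size ws <= r)%N -> iter_derive ws (p K1) x = iter_derive ws (p K2) x.
Proof.
move=> kr NF pp pd K1 K2 x T1 T2 x1 x2 ws wsr.
have [F [F1 F2 FE]] := triangulation_conforming OT T1 T2.
have Fx : conv_hull F x by rewrite -FE.
have [c1 r1] := triangulation_simplex OT T1; have [c2 _] := triangulation_simplex OT T2.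
have F0 : F != fset0.
  apply/eqP => F0; move: Fx; rewrite F0 => -[l [_ + _]].
  rewrite big1 => [/eqP|v _]; first by rewrite eq_sym oner_eq0.
  by have := valP v; rewrite inE.
(* A common face with [d.+1] vertices is each of the two simplices, so there is nothing to
   compare. *)
have [Fd|dF] := leqP #|` F| d; last first.
  suff -> : K1 = K2 by [].
  have E K : (F `<=` K)%fset -> #|` K| = d.+1 -> F = K.
    by move=> FK cK; apply/eqP; rewrite eqEfcard FK cK.
  by rewrite -(E _ F1 c1) -(E _ F2 c2).
have Fx' : aff_hull F x by have [l [_ l1 ->]] := Fx; exists l.
have NFE E : subsimplex E F -> normal_frame (normal E).
  move=> /andP[E0 EF]; have EK1 := fsubset_trans EF F1.
  have [NN EN] : normal E *m (normal E)^T = 1%:M /\ edge_mx E *m (normal E)^T = 0.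
    by apply: NF T1 _; rewrite /subsimplex E0.
  by split => //; exact: aff_freeS EK1 (aff_free_row_free r1).
have dE E : subsimplex E F -> dofs_eq r k normal E (p K1) (p K2).
  move=> /andP[E0 EF]; apply: pd => //; rewrite /subsimplex ?E0 ?(fsubset_trans EF)//.
  exact: leq_trans (fsubset_leq_card EF) Fd.
have FF : subsimplex F F by rewrite /subsimplex F0 fsubset_refl.
have := dofs_flat kr (polys_polyfun (pp _ T1)) (polys_polyfun (pp _ T2)) NFE dE FF Fx' (ws := ws).
rewrite (iter_deriveB _ (polys_polyfun (pp _ T1)) (polys_polyfun (pp _ T2))).
move=> H; apply/eqP; rewrite -subr_eq0; apply/eqP/H.
(* [F] has codimension [s >= 1], so its order [2 ^ (s - 1) * r] is at least [r]. *)
apply: leq_trans wsr _; rewrite /codim subSn//=.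
by rewrite leq_pmull// expn_gt0.
Qed.

(** [T] may be infinite, so the exceptional null sets are combined over countably many rational
    boxes, each used only when it meets finitely many simplices. *)
Lemma ae_pieces (u : 'rV[R]_d -> R) (p : {fset 'rV[R]_d} -> 'rV[R]_d -> R) :
  (forall K, T K -> u = p K %[ae lebesgue_rV d in conv_hull K]) ->
  \forall x \ae lebesgue_rV d, Omega x -> forall K, T K -> conv_hull K x -> u x = p K x.
Proof.
move=> up.
pose B (z : 'rV[rat]_d * nat) : set 'rV[R]_d :=
  [set y | forall i, `|y 0 i - ratr (z.1 0 i)| < z.2.+1%:R^-1].
pose TB z := [set K | T K /\ conv_hull K `&` B z !=set0].
have aeB z : \forall x \ae lebesgue_rV d, finite_set (TB z) ->
    forall K, TB z K -> conv_hull K x -> u x = p K x.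
  have [/finite_fsetP[X XE]|nfin] := pselect (finite_set (TB z)); last first.
    by apply: aeW => x /nfin.
  have : \forall x \ae lebesgue_rV d, forall K : X, conv_hull (val K) x -> u x = p (val K) x.
    apply: filter_forall => K; apply: up.
    have : [set` X] (val K) by exact: (valP K).
    by rewrite -XE => -[].
  apply: filterS => x H _ K; rewrite XE /= => KX.
  exact: (H [` KX]%fset).
have base n : \forall x \ae lebesgue_rV d, forall z, choice.unpickle n = Some z ->
    finite_set (TB z) -> forall K, TB z K -> conv_hull K x -> u x = p K x.
  case E : (choice.unpickle n) => [z|]; last by apply: aeW.
  by apply: filterS (aeB z) => x H _ [<-].
have := ae_foralln base.
apply: filterS => x H Ox K TK Kx.
have [U Ux Ufin] := triangulation_locally_finite OT Ox.
have /nbhs_ballP[e /= e0 eU] := Ux.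
(* Two points of a box of half-width below [e / 2] are less than [e] apart, so the box around [x]
   lies in [U]. *)
have [m] := ltr_add_invr (divr_gt0 e0 (ltr0n _ 2)); rewrite add0r => me.
have /choice[q qP] i : exists q : rat, `|x 0 i - ratr q| < m.+1%:R^-1.
  have m0 : 0 < m.+1%:R^-1 :> R by rewrite invr_gt0.
  have lt_x : x 0 i - m.+1%:R^-1 < x 0 i + m.+1%:R^-1.
    by rewrite ltrD2l; apply: lt_trans m0; rewrite oppr_lt0.
  have [q] := rat_in_itvoo lt_x.
  by rewrite in_itv /= => qx; exists q; rewrite distrC ltr_distl.
pose z : 'rV[rat]_d * nat := (\row_i q i, m).
have Bx : B z x by move=> i; rewrite /= mxE.
apply: (H (choice.pickle z) z (choice.pickleK z) _ K) => //; last by split=> //; exists x.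
apply: sub_finite_set Ufin => K' [TK' [y [K'y By]]]; split=> //; exists y; split=> //.
apply: eU; split=> // i j; rewrite [i]ord1 /ball /=.
have := By j; have := Bx j; rewrite /= !mxE.
move: (x 0 j) (y 0 j) (ratr (q j)) m.+1%:R^-1 me => a b c s se.
by rewrite !ltr_norml; lra.
Qed.

End triangulated_domains.

Theorem theorem1p1 (R : realType) (d r k : nat)
  (Omega : set 'rV[R]_d) (T : set {fset 'rV[R]_d})
  (normal : forall F : {fset 'rV[R]_d}, 'M[R]_(codim F, d)) :
  (1 <= d)%N -> (2 ^ d * r + 1 <= k)%N ->
  is_domain Omega -> triangulation Omega T -> normal_frames T normal ->
  (forall K, T K -> unisolvent r k normal K) /\
  fe_space r k normal T Omega `<=` Cr_ae r Omega.
Proof.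
move=> _ kr [oO _ _] OT NF; split.
  move=> K TK; have [cK rK] := triangulation_simplex OT TK.
  apply: unisolvent_simplex => // F /[dup] FK /andP[F0 FsK].
  have [NN EN] := NF _ _ TK FK.
  by split=> //; exact: aff_freeS FsK (aff_free_row_free rK).
move=> u [_ [p [pT pd]]].
have kr' : (2 ^ d * r <= k)%N by rewrite (leq_trans _ kr)// leq_addr.
have pp K : T K -> polys k (p K) by move=> /pT[].
have agree := pieces_agree OT kr' NF pp pd.
(* The continuous representative picks any simplex containing [x]; agreement at order 0 makes the
   choice irrelevant. *)
pose g x := p (xget fset0 [set K | T K /\ conv_hull K x]) x.
have gE K x : T K -> conv_hull K x -> g x = p K x.
  move=> TK Kx; rewrite /g; case: xgetP => [K' _ [TK' K'x]|/(_ K)]; last by case.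
  exact: (agree _ _ _ TK' TK K'x Kx [::] isT).
exists g; split.
  apply: (@Cr_glue R d _ Omega T (@conv_hull R d) _ k r g p) => //.
  - by move=> x; exact: triangulation_near.
  - by move=> K /pp; exact: polys_polyfun.
  - by move=> K x _; exact: gE.
have := ae_pieces OT (fun K TK => proj2 (pT K TK)).
apply: filterS => x H Ox; have [K TK Kx] := triangulation_cover OT Ox.
by rewrite (H Ox K)// (gE K).
Qed.
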